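(* Let $\mathcal{F}(x)=\sum_{n\le x}\mu(n)\log\frac{x}{n}$ for real $x\ge 1$, let $\mathcal{H}(x)=e^{-\sqrt{x}}\,\mathcal{F}\left(e^{\sqrt{x}}\right)$ for real $x\ge 0$, and let $\ell=\limsup_{x\to+\infty}|\mathcal{H}(x)|$. Then $\ell=0$.
   Context: Here $\mu$ denotes the Möbius function, $\log$ is the natural logarithm, and sums over $n\le x$ run over positive integers $n\le x$. Writing $M(x)=\sum_{n\le x}\mu(n)$, one has $\mathcal{F}(x)=\int_1^x\frac{M(y)}{y}\,dy$. *)

(* Defs.v *)
From mathcomp Require Import all_boot all_order all_algebra.
From mathcomp Require Import all_classical all_reals all_analysis.

Set Implicit Arguments.
Unset Strict Implicit.
Unset Printing Implicit Defensive.

Import Order.TTheory GRing.Theory Num.Theory.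
Import numFieldNormedType.Exports.

Local Open Scope classical_set_scope.
Local Open Scope ring_scope.

(* The value at 0, where primes 0 = [::], is junk and is never used below. *)
Definition moebius (n : nat) : int :=
  if all (fun p => ~~ (p ^ 2 %| n)%N) (primes n)
  then (-1) ^+ size (primes n) else 0.

(* For x >= 0, Num.truncn x is the integer part of x, so n ranges over the
   integers 1 <= n <= x; the sum is empty for x < 1. *)
Definition moebius_log_sum (R : realType) (x : R) : R :=
  \sum_(1 <= n < (Num.truncn x).+1) (moebius n)%:~R * ln (x / n%:R).

(* Intended for x >= 0; Num.sqrt x = 0 for x < 0, which does not affect the
   behaviour at +oo. *)
Definition scaled_sum (R : realType) (x : R) : R :=
  expR (- Num.sqrt x) * moebius_log_sum (expR (Num.sqrt x)).

Definition limsup_scaled_sum (R : realType) : \bar R :=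
  limf_esup (fun x : R => `|scaled_sum x|%:E) (pinfty_nbhs R).

(* Main.v *)
(* Put F(N) = sum_{n <= N} mu(n) ln(N/n).  Since F' = M(y)/y with |M(y)| <= y, F is
   1-Lipschitz, and it suffices to prove F(N) = o(N).  The Dirichlet convolution identities
   mu ln = - Lambda * mu and mu ln^2 = (Lambda * Lambda - Lambda ln) * mu, together with
   Selberg's formula sum_{n <= N} (Lambda * Lambda + Lambda ln)(n) = 2 N ln N + O(N), give
     |F(N)| ln^2 N <= 2 N sum_{m <= N} |F(m)| / (m (m + 1)) ln(N/m) + O(N (1 + ln N)),
   so that limsup |F(N)|/N is at most the limsup of the logarithmic means of |F(m)|/m.
   If |F(m)| <= al m eventually with al > 0, these means stay strictly below al: the sums
   sum_{m <= N} F(m) / (m (m + 1)) are bounded, hence on every long multiplicative block F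
   either keeps its sign, and contributes little, or comes within 1 of 0, and then stays small
   nearby by the Lipschitz property.  Thus al can be lowered by an amount bounded below as long
   as al is, and iterating brings it down to 0. *)

Require Import Defs.
From mathcomp Require Import all_boot all_order all_algebra.
From mathcomp Require Import all_classical all_reals all_analysis.
From mathcomp Require Import zify ring lra.

Set Implicit Arguments.
Unset Strict Implicit.
Unset Printing Implicit Defensive.

Import Order.TTheory GRing.Theory Num.Theory.
Import numFieldNormedType.Exports.

Local Open Scope ring_scope.

(** * Dirichlet convolution *)

Section DirichletConvolution.
Variable R : comNzRingType.
Implicit Types (f g h : nat -> R) (n d N : nat).

Lemma sum_multiples f N d : (0 < d)%N ->
  \sum_(1 <= n < N.+1 | (d %| n)%N) f n =
  \sum_(1 <= k < (N %/ d).+1) f (d * k)%N.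
Proof.
move=> d0; elim: N => [|N IH]; first by rewrite div0n !big_geq.
rewrite big_mkcond big_nat_recr//= -big_mkcond/= IH divnS//.
case: ifPn => dN; last by rewrite add0n addr0.
rewrite add1n [RHS]big_nat_recr//=; congr (_ + f _).
by rewrite -[LHS](divnK dN) divnS// dN add1n mulnC.
Qed.

Lemma sum_divisors_widen f n N : (0 < n <= N)%N ->
  \sum_(1 <= d < n.+1 | (d %| n)%N) f d = \sum_(1 <= d < N.+1 | (d %| n)%N) f d.
Proof.
move=> /andP[n0 nN]; rewrite (big_nat_widen _ _ N.+1)// big_nat_cond [RHS]big_nat_cond.
apply: eq_bigl => d; rewrite !ltnS; case: (boolP (d %| n)%N) => //= dn.
by rewrite (dvdn_leq n0 dn).
Qed.

Lemma sum_divisor_pairs (h : nat -> nat -> R) N :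
  \sum_(1 <= n < N.+1) \sum_(1 <= d < n.+1 | (d %| n)%N) h d (n %/ d)%N =
  \sum_(1 <= d < N.+1) \sum_(1 <= k < (N %/ d).+1) h d k.
Proof.
transitivity (\sum_(1 <= n < N.+1) \sum_(1 <= d < N.+1 | (d %| n)%N) h d (n %/ d)%N).
  by apply: eq_big_nat => n; rewrite ltnS => /sum_divisors_widen ->.
under eq_bigr do rewrite big_mkcond/=.
rewrite exchange_big_nat/=; apply: eq_big_nat => d /andP[d0 _].
rewrite -big_mkcond/= sum_multiples//; apply: eq_bigr => k _.
by rewrite mulKn.
Qed.

Definition conv f g n := \sum_(1 <= d < n.+1 | (d %| n)%N) f d * g (n %/ d)%N.

Lemma eq_conv f f' g g' n :
  (forall m, (0 < m)%N -> f m = f' m) -> (forall m, (0 < m)%N -> g m = g' m) ->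
  conv f g n = conv f' g' n.
Proof.
move=> ff' gg'; rewrite /conv big_nat_cond [RHS]big_nat_cond.
apply: eq_bigr => d /andP[/andP[d0 dn] dvd]; rewrite ff'// gg'//.
by rewrite divn_gt0// -ltnS.
Qed.

(** Writing n = d k turns sums of convolutions into iterated sums. The free weight [w] later carries
    indicators, constants and powers of ln (N / n). *)
Lemma sum_conv f g (w : nat -> R) N :
  \sum_(1 <= n < N.+1) conv f g n * w n =
  \sum_(1 <= d < N.+1) f d * \sum_(1 <= k < (N %/ d).+1) g k * w (d * k)%N.
Proof.
under eq_bigr do rewrite mulr_suml.
pose h d k := f d * g k * w (d * k)%N.
transitivity (\sum_(1 <= n < N.+1) \sum_(1 <= d < n.+1 | (d %| n)%N) h d (n %/ d)%N).
  by apply: eq_bigr => n _; apply: eq_bigr => d dn; rewrite /h (mulnC d) divnK.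
rewrite sum_divisor_pairs; apply: eq_bigr => d _; rewrite mulr_sumr.
by apply: eq_bigr => k _; rewrite mulrA.
Qed.

Lemma convC f g n : conv f g n = conv g f n.
Proof.
case: n => [|n]; first by rewrite /conv !big_geq.
(* Both orders reduce to a sum over the pairs with d k = n + 1, a form symmetric in the two
   factors. *)
have E (h1 h2 : nat -> R) : conv h1 h2 n.+1 = \sum_(1 <= d < n.+2) \sum_(1 <= k < n.+2)
    (if (d * k == n.+1)%N then h1 d * h2 k else 0).
  rewrite /conv big_mkcond/=; apply: eq_big_nat => d /andP[d0 dn].
  case: ifPn => dvd; last first.
    rewrite big1// => k _; case: eqP => // E; case/negP: dvd.
    by rewrite -E dvdn_mulr.
  rewrite (bigD1_seq (n.+1 %/ d)%N) ?iota_uniq//=; last first.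
    by rewrite mem_index_iota ltnS leq_div divn_gt0// -ltnS dn.
  rewrite mulnC divnK// eqxx big1 ?addr0// => k kd; case: eqP => // E.
  by case/eqP: kd; rewrite -E mulKn.
rewrite !E exchange_big_nat/=; apply: eq_bigr => k _; apply: eq_bigr => d _.
by rewrite mulnC mulrC.
Qed.

Lemma convA f g h n : conv (conv f g) h n = conv f (conv g h) n.
Proof.
have dvdKr d k : (0 < n)%N -> (0 < d)%N -> (d * k %| n)%N -> (d %| n)%N && (k %| n %/ d)%N.
  move=> n0 d0 dkn; have dn : (d %| n)%N := dvdn_trans (dvdn_mulr k (dvdnn d)) dkn.
  by rewrite dn -(@dvdn_pmul2l d)// [(d * (n %/ d))%N]mulnC divnK.
case: (posnP n) => [->|n0]; first by rewrite /conv !big_geq.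
rewrite {1}/conv big_mkcond/=.
(* The condition that m divides n is moved into a weight, so that [sum_conv] opens the inner
   convolution. *)
transitivity (\sum_(1 <= m < n.+1) conv f g m * (if (m %| n)%N then h (n %/ m)%N else 0)).
  by apply: eq_bigr => m _; case: ifP; rewrite ?mulr0.
rewrite sum_conv {2}/conv [RHS]big_mkcond/=; apply: eq_big_nat => d /andP[d0 dn].
case: ifPn => dvd; last first.
  rewrite big1 ?mulr0// => k _; case: ifPn; rewrite ?mulr0// => /(dvdKr _ _ n0 d0).
  by rewrite (negbTE dvd).
rewrite /conv [in RHS]big_mkcond/=; congr (_ * _); apply: eq_big_nat => k /andP[k0 kn].
rewrite divnMA -[in (_ %| n)%N](divnK dvd) [(n %/ d * d)%N]mulnC dvdn_pmul2l//.
by case: ifP; rewrite ?mulr0.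
Qed.

Definition conv_unit n : R := (n == 1%N)%:R.

Lemma conv_unitr f n : (0 < n)%N -> conv f conv_unit n = f n.
Proof.
move=> n0; rewrite /conv big_mkcond (bigD1_seq n) ?iota_uniq ?mem_index_iota ?n0 ?ltnSn//=.
rewrite dvdnn divnn n0 mulr1 big1 ?addr0// => d dn; case: ifPn => // dvd.
rewrite /conv_unit; case: eqP => [E|]; last by rewrite mulr0.
by case/eqP: dn; rewrite -[RHS](divnK dvd) E mul1n.
Qed.

Lemma convDl f g h n : conv (fun m => f m + g m) h n = conv f h n + conv g h n.
Proof. by rewrite /conv -big_split/=; apply: eq_bigr => d _; rewrite mulrDl. Qed.

Lemma convNl f g n : conv (fun m => - f m) g n = - conv f g n.
Proof. by rewrite /conv -sumrN; apply: eq_bigr => d _; rewrite mulNr. Qed.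

Lemma convNr f g n : conv f (fun m => - g m) n = - conv f g n.
Proof. by rewrite /conv -sumrN; apply: eq_bigr => d _; rewrite mulrN. Qed.

(* A completely additive function acts as a derivation of the convolution ring. *)
Lemma conv_deriv (D : nat -> R) f g n :
  (forall a b, (0 < a)%N -> (0 < b)%N -> D (a * b)%N = D a + D b) ->
  conv f g n * D n = conv (fun m => f m * D m) g n + conv f (fun m => g m * D m) n.
Proof.
move=> Dadd; rewrite /conv mulr_suml -big_split/= big_nat_cond [RHS]big_nat_cond.
apply: eq_bigr => d /andP[/andP[d0 dn] dvd].
have q0 : (0 < n %/ d)%N by rewrite divn_gt0// -ltnS.
by rewrite -[in D n](divnK dvd) Dadd//; ring.
Qed.

End DirichletConvolution.
Arguments eq_conv {R f f' g g' n}.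

(** * The functions of Moebius, von Mangoldt and Selberg *)

Section Moebius.
Local Open Scope nat_scope.

Lemma perm_primes_mul p n : prime p -> 0 < n -> ~~ (p %| n) ->
  perm_eq (primes (p * n)) (p :: primes n).
Proof.
move=> pp n0 pn; apply: uniq_perm; rewrite ?primes_uniq//=.
  by rewrite primes_uniq mem_primes (negbTE pn) !andbF.
by move=> q; rewrite primesM ?(prime_gt0 pp)// primes_prime// !inE.
Qed.

Lemma moebius_mul_prime p n : prime p -> 0 < n ->
  moebius (p * n) = (if (p %| n)%N then 0 else - moebius n)%R.
Proof.
move=> pp n0; have p0 := prime_gt0 pp; rewrite /moebius; case: (boolP (p %| n)) => pn.
  rewrite ifF//; apply/negbTE/allPn; exists p.
    by rewrite mem_primes pp muln_gt0 p0 n0 dvdn_mulr.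
  by rewrite negbK expnS expn1 dvdn_pmul2l.
rewrite (perm_all _ (perm_primes_mul pp n0 pn)) (perm_size (perm_primes_mul pp n0 pn))/=.
rewrite [in (p ^ 2)%N]expnS expn1 dvdn_pmul2l// pn/=.
have -> : all (fun q => ~~ (q ^ 2 %| p * n)) (primes n) =
          all (fun q => ~~ (q ^ 2 %| n)) (primes n).
  apply: eq_in_all => q; rewrite mem_primes => /and3P[pq _ qn].
  rewrite Gauss_dvdr// coprimeXl// prime_coprime// dvdn_prime2//.
  by apply/eqP => qp; rewrite qp (negbTE pn) in qn.
by case: ifP => _; rewrite ?oppr0// exprS mulN1r.
Qed.

End Moebius.

Section ArithmeticFunctions.
Variable R : realType.
Implicit Types n d N : nat.

Definition mu n : R := (moebius n)%:~R.

Lemma mu1 : mu 1 = 1.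
Proof. by []. Qed.

Lemma norm_mu_le1 n : `|mu n| <= 1.
Proof.
rewrite /mu /moebius; case: ifP; rewrite ?normr0// => _.
by rewrite rmorphXn/= rmorphN1 normrX normrN1 expr1n.
Qed.

(** For n = p m with p prime, a divisor p d contributes - mu(d) if p does not divide d, and 0
    otherwise. These terms cancel those of the divisors of n prime to p, which are the divisors of m
    prime to p. *)
Lemma conv_mu_one n : (0 < n)%N -> conv mu (fun=> 1) n = conv_unit R n.
Proof.
move=> n0; rewrite /conv_unit; case: eqP => [->|n1].
  by rewrite /conv big_mkcond big_nat1/= mu1 mulr1.
have [p pp /dvdnP[m nE]] : {p : nat | prime p & (p %| n)%N}.
  by apply: pdivP; rewrite ltn_neqAle eq_sym; apply/andP; split; [exact/eqP|].
have p0 := prime_gt0 pp.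
have m0 : (0 < m)%N by case: m nE n0 => // ->.
rewrite /conv (bigID (fun d => (p %| d)%N))/=.
have -> : \sum_(1 <= d < n.+1 | (d %| n)%N && (p %| d)%N) mu d * 1 =
   - \sum_(1 <= d < m.+1 | (d %| m)%N && ~~ (p %| d)%N) mu d.
  under eq_bigl do rewrite andbC.
  rewrite big_mkcondr sum_multiples//= nE mulnK// -sumrN [RHS]big_mkcond.
  apply: eq_big_nat => d /andP[d0 _]; rewrite [(m * p)%N]mulnC dvdn_pmul2l//.
  rewrite /mu moebius_mul_prime//.
  by case: (d %| m)%N => //=; case: (p %| d)%N; rewrite /= ?mulr0z ?mul0r ?mulr1 ?mulrNz.
have -> : \sum_(1 <= d < n.+1 | (d %| n)%N && ~~ (p %| d)%N) mu d * 1 =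
    \sum_(1 <= d < m.+1 | (d %| m)%N && ~~ (p %| d)%N) mu d.
  rewrite [RHS]big_mkcondr/=.
  rewrite (sum_divisors_widen (fun d => if ~~ (p %| d)%N then mu d else 0) (N := n)).
    rewrite -big_mkcondr; under eq_bigr do rewrite mulr1.
    apply: eq_bigl => d; rewrite andbC [RHS]andbC; case: (boolP (p %| d)%N) => //= pd.
    by rewrite nE Gauss_dvdl// coprime_sym prime_coprime.
  by rewrite m0 nE leq_pmulr.
by rewrite addNr.
Qed.

Lemma moebius_inversion (f g : nat -> R) :
  (forall n, (0 < n)%N -> conv f (fun=> 1) n = g n) ->
  forall n, (0 < n)%N -> f n = conv mu g n.
Proof.
move=> fg n n0; rewrite -(conv_unitr f n0) -(eq_conv (fun=> fun=> erefl) conv_mu_one).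
rewrite [in LHS](eq_conv (fun=> fun=> erefl) (fun m _ => convC mu _ m)) -convA convC.
exact: eq_conv.
Qed.

(** A positive integer is a prime power p^k with k >= 1 exactly when p is the only entry of its list
    of distinct prime factors. *)
Definition vonMangoldt n : R := if primes n is [:: p] then ln p%:R else 0.
Local Notation Lam := vonMangoldt.

Lemma vonMangoldt_ge0 n : 0 <= Lam n.
Proof.
rewrite /Lam; case E : (primes n) => [//|p [|//]].
apply: ln_ge0; rewrite ler1n; apply: prime_gt0.
by have : p \in primes n; [rewrite E inE|rewrite mem_primes => /and3P[]].
Qed.

Lemma vonMangoldt_pexp p k : prime p -> Lam (p ^ k.+1) = ln p%:R.
Proof. by move=> pp; rewrite /Lam primesX// primes_prime. Qed.

Lemma vonMangoldt_neq0 n : (0 < n)%N -> Lam n != 0 ->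
  exists p k, prime p /\ n = (p ^ k)%N.
Proof.
move=> n0; rewrite /Lam; case E : (primes n) => [|p [|]]; rewrite ?eqxx// => _.
have pn : p.-nat n by rewrite /pnat n0 E /= !inE eqxx.
have [k nk] := p_natP pn; exists p, k; split => //.
by have : p \in primes n; [rewrite E inE|rewrite mem_primes => /and3P[]].
Qed.

(** Among the divisors of p m that do not divide m, the only prime power is p^(v + 1), where v is
    the exponent of p in m. *)
Lemma sum_vonMangoldt_mul_prime p m : prime p -> (0 < m)%N ->
  \sum_(1 <= d < (p * m).+1 | (d %| p * m)%N) Lam d =
  \sum_(1 <= d < m.+1 | (d %| m)%N) Lam d + ln p%:R.
Proof.
move=> pp m0; have p0 := prime_gt0 pp.
have n0 : (0 < p * m)%N by rewrite muln_gt0 p0.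
rewrite (bigID (fun d => (d %| m)%N))/=; congr (_ + _).
  rewrite (sum_divisors_widen _ (N := (p * m)%N)) ?m0 ?leq_pmull//.
  apply: eq_bigl => d; case: (boolP (d %| m)%N) => dm; rewrite ?andbF// andbT.
  by rewrite dvdn_mull.
set q := (p ^ (logn p m).+1)%N.
have lpm : logn p (p * m) = (logn p m).+1 by rewrite lognM// logn_prime// eqxx.
rewrite big_mkcond (bigD1_seq q) ?iota_uniq//=; last first.
  rewrite mem_index_iota ltnS expn_gt0 p0/= dvdn_leq//.
  by rewrite pfactor_dvdn// lpm.
rewrite !pfactor_dvdn// lpm leqnn ltnn/= vonMangoldt_pexp// big1_seq ?addr0// => d.
rewrite mem_index_iota => /andP[dq /andP[d0 _]]; case: ifPn => // /andP[dn ndm].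
apply/eqP/negPn/negP => /(vonMangoldt_neq0 d0)[r [k [pr dE]]].
have [rp|rp] := eqVneq r p.
  move: dn ndm dq; rewrite dE rp !pfactor_dvdn// lpm /q => k1 k2.
  by have -> : k = (logn p m).+1; [lia|rewrite eqxx].
move: dn ndm; rewrite dE Gauss_dvdr ?(negbTE ndm)// => [->//|].
by rewrite coprimeXl// prime_coprime// dvdn_prime2.
Qed.

Lemma ln_natM a b : (0 < a)%N -> (0 < b)%N ->
  ln (a * b)%:R = ln a%:R + ln b%:R :> R.
Proof. by move=> a0 b0; rewrite natrM lnM// posrE ltr0n. Qed.

Lemma conv_vonMangoldt_one n : (0 < n)%N -> conv Lam (fun=> 1) n = ln n%:R.
Proof.
have -> : conv Lam (fun=> 1) n = \sum_(1 <= d < n.+1 | (d %| n)%N) Lam d.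
  by apply: eq_bigr => d _; rewrite mulr1.
elim/ltn_ind: n => n IH n0; have [->|n1] := eqVneq n 1%N.
  by rewrite big_mkcond big_nat1/= ln1.
have [p pp /dvdnP[m nE]] : {p : nat | prime p & (p %| n)%N}.
  by apply: pdivP; rewrite ltn_neqAle eq_sym n1.
have m0 : (0 < m)%N by case: m nE n0 => // ->.
have mn : (m < n)%N by rewrite nE ltn_Pmulr// prime_gt1.
by rewrite nE mulnC sum_vonMangoldt_mul_prime// IH// (ln_natM (prime_gt0 pp) m0) addrC.
Qed.

Local Notation log := (fun n : nat => ln n%:R : R).

Lemma vonMangoldtE n : (0 < n)%N -> Lam n = conv mu log n.
Proof. exact: (moebius_inversion conv_vonMangoldt_one). Qed.


Lemma conv_log (f g : nat -> R) n :
  conv f g n * ln n%:R = conv (fun m => f m * ln m%:R) g n + conv f (fun m => g m * ln m%:R) n.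
Proof. exact: (conv_deriv f g n ln_natM). Qed.

(** Multiplication by ln is a derivation that kills the unit mu * 1. Hence the convolution of mu ln
    with 1 is that of - mu with ln, namely - Lambda, and Moebius inversion concludes. *)
Lemma mu_log n : (0 < n)%N -> mu n * ln n%:R = - conv Lam mu n.
Proof.
rewrite convC -convNr; move: n; apply: moebius_inversion => n n0.
rewrite (vonMangoldtE n0).
rewrite (eq_conv (g := log) (g' := fun m => 1 * ln m%:R) (fun=> fun=> erefl)); last first.
  by move=> m _; rewrite mul1r.
apply/eqP; rewrite -addr_eq0 -(conv_log mu (fun=> 1) n) conv_mu_one//.
by rewrite /conv_unit; case: (eqVneq n 1%N) => [->|_]; rewrite ?ln1 ?mulr0 ?mul0r.
Qed.

(** Selberg's function, which is also the convolution of [mu] with ln^2. *)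
Definition selbergLambda n : R := conv Lam Lam n + Lam n * ln n%:R.

(** The derivation is applied once more to the convolution in [mu_log], and the factor mu ln that
    appears is again replaced by - Lambda * mu. *)
Lemma mu_log2 n : (0 < n)%N ->
  mu n * ln n%:R ^+ 2 = conv (fun m => conv Lam Lam m - Lam m * ln m%:R) mu n.
Proof.
move=> n0; rewrite expr2 mulrA mu_log// mulNr conv_log.
rewrite (eq_conv (g' := fun m => - conv Lam mu m) (fun=> fun=> erefl) mu_log).
by rewrite convNr -convA convDl convNl opprD opprK addrC.
Qed.

End ArithmeticFunctions.

(** * Sums of logarithms *)

Section LogarithmicSums.
Variable R : realType.
Implicit Types (n k d K N : nat) (a b x y : R).

Lemma ln_sub_le a b : 0 < a -> 0 < b -> ln b - ln a <= (b - a) / a.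
Proof.
move=> a0 b0; rewrite -ln_div ?posrE//.
have -> : b / a = 1 + (b - a) / a by field; rewrite gt_eqF.
apply: le_ln1Dx; have : 0 < b / a by rewrite divr_gt0.
have -> : b / a = 1 + (b - a) / a by field; rewrite gt_eqF.
lra.
Qed.

Lemma ln_sub_ge a b : 0 < a -> 0 < b -> (b - a) / b <= ln b - ln a.
Proof.
move=> a0 b0; have := ln_sub_le b0 a0; rewrite -[a - b]opprB mulNr; lra.
Qed.

Lemma lnS_sub_bounds n : (0 < n)%N ->
  n.+1%:R^-1 <= (ln n.+1%:R - ln n%:R : R) <= n%:R^-1.
Proof.
move=> n0; have p : 0 < n%:R :> R by rewrite ltr0n.
have q : 0 < n.+1%:R :> R by rewrite ltr0n.
have E : n.+1%:R - n%:R = 1 :> R by rewrite -natr1; ring.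
have := ln_sub_ge p q; have := ln_sub_le p q.
by rewrite E !mul1r => -> ->.
Qed.

Lemma ln_nat_ge0 n : 0 <= ln n%:R :> R.
Proof. by case: n => [|n]; [rewrite ln0|rewrite ln_ge0// ler1n]. Qed.

Lemma divn_bounds N d : (0 < d <= N)%N ->
  [/\ (0 < N %/ d)%N, 0 < (N %/ d)%:R :> R, (N %/ d)%:R <= N%:R / d%:R :> R
    & N%:R / d%:R <= (N %/ d)%:R + 1 :> R].
Proof.
move=> /andP[d0 dN]; have K0 : (0 < N %/ d)%N by rewrite divn_gt0.
split=> //; first by rewrite ltr0n.
  by rewrite ler_pdivlMr ?ltr0n// -natrM ler_nat leq_divM.
by rewrite ler_pdivrMr ?ltr0n// natr1 -natrM ler_nat ltnW// ltn_ceil.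
Qed.

Lemma ln_div_nat_ge0 N d : (d <= N)%N -> 0 <= ln (N%:R / d%:R) :> R.
Proof.
case: d => [_|d dN]; first by rewrite invr0 mulr0 ln0.
by rewrite ln_ge0// ler_pdivlMr ?ltr0n// mul1r ler_nat.
Qed.

Lemma ln_div_nat N d : (0 < d)%N -> (0 < N)%N ->
  ln (N%:R / d%:R) = ln N%:R - ln d%:R :> R.
Proof. by move=> d0 N0; rewrite ln_div// posrE ltr0n. Qed.

Lemma expr_sub_le k a b : 0 <= a <= b ->
  b ^+ k.+1 - a ^+ k.+1 <= k.+1%:R * (b - a) * b ^+ k.
Proof.
move=> /andP[a0 ab]; elim: k => [|k IH]; first by rewrite !expr1 expr0; lra.
have E1 : a ^+ k.+1 <= b ^+ k.+1 by rewrite lerXn2r ?nnegrE//; lra.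
rewrite ![_ ^+ k.+2]exprS -(natr1 k.+1).
have -> : b * b ^+ k.+1 - a * a ^+ k.+1 =
   b * (b ^+ k.+1 - a ^+ k.+1) + (b - a) * a ^+ k.+1 by ring.
have b0 : 0 <= b by lra.
have := ler_wpM2l b0 IH.
have ba : 0 <= b - a by lra.
have := ler_wpM2l ba E1; rewrite ![b ^+ k.+1]exprS.
lra.
Qed.

(** Induction on k. Going from N to N + 1 raises every logarithm by at most 1 / N, hence the sum of
    the powers k + 1 by at most (k + 1) / N times the sum of the powers k, which is O(N): each step
    adds a bounded amount. *)
Lemma sum_ln_pow k : exists2 C : R, 0 <= C &
  forall N, \sum_(1 <= d < N.+1) ln (N%:R / d%:R) ^+ k <= C * N%:R.
Proof.
elim: k => [|k [C C0 IH]].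
  by exists 1 => // N; under eq_bigr do rewrite expr0; rewrite sumr_const_nat mul1r subn1.
exists (2 * k.+1%:R * C) => [|N]; first by rewrite !mulr_ge0.
elim: N => [|N IHN]; first by rewrite big_geq// mulr0.
rewrite big_nat_recr//= divff ?pnatr_eq0// ln1 expr0n addr0.
have [->|N0] := posnP N; first by rewrite big_geq// !mulr_ge0.
have step d : (0 < d <= N)%N -> ln (N.+1%:R / d%:R) ^+ k.+1 <=
    ln (N%:R / d%:R) ^+ k.+1 + k.+1%:R / N%:R * ln (N.+1%:R / d%:R) ^+ k :> R.
  move=> /andP[d0 dN]; have a0 := ln_div_nat_ge0 dN.
  have b0 := ln_div_nat_ge0 (leqW dN).
  have : ln (N.+1%:R / d%:R) - ln (N%:R / d%:R) = ln N.+1%:R - ln N%:R :> R.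
    by rewrite !ln_div_nat//; ring.
  have /andP[h1 h2] := lnS_sub_bounds N0 => hd.
  have i0 : 0 <= N.+1%:R^-1 :> R by rewrite invr_ge0.
  have ab : 0 <= (ln (N%:R / d%:R) : R) <= ln (N.+1%:R / d%:R).
    by rewrite a0/= -subr_ge0 hd (le_trans i0).
  have := expr_sub_le k ab; rewrite hd => h3.
  have : k.+1%:R * (ln N.+1%:R - ln N%:R) * ln (N.+1%:R / d%:R) ^+ k <=
     k.+1%:R / N%:R * ln (N.+1%:R / d%:R) ^+ k :> R.
    by rewrite ler_wpM2r ?exprn_ge0// ler_wpM2l.
  lra.
have : \sum_(1 <= d < N.+1) ln (N.+1%:R / d%:R) ^+ k.+1 <=
    \sum_(1 <= d < N.+1) ln (N%:R / d%:R) ^+ k.+1 +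
    k.+1%:R / N%:R * \sum_(1 <= d < N.+1) ln (N.+1%:R / d%:R) ^+ k :> R.
  by rewrite mulr_sumr -big_split; apply: ler_sum_nat => d dN; apply: step.
move=> /le_trans; apply; rewrite -[N.+1%:R in leRHS]natr1 mulrDr mulr1 lerD//.
have := IH N.+1; rewrite big_nat_recr//= divff ?pnatr_eq0// ln1 => h.
have h' : \sum_(1 <= d < N.+1) ln (N.+1%:R / d%:R) ^+ k <= C * (2 * N%:R) :> R.
  apply: le_trans (le_trans h _); first by rewrite lerDl exprn_ge0.
  by rewrite ler_wpM2l// -natrM ler_nat; lia.
have kN : 0 <= k.+1%:R / N%:R :> R by rewrite divr_ge0.
apply: le_trans (ler_wpM2l kN h') _; rewrite le_eqVlt; apply/orP; left; apply/eqP.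
by field; rewrite pnatr_eq0 -lt0n.
Qed.

(** The sequence [u - e] increases, [u + e] decreases, and the first stays below the second; l is
    the supremum of [u - e]. *)
Lemma squeezed_limit (u e : nat -> R) :
  (forall n, (0 < n)%N -> 0 <= e n) ->
  (forall n, (0 < n)%N -> `|u n.+1 - u n| <= e n - e n.+1) ->
  exists l, forall n, (0 < n)%N -> `|u n - l| <= e n.
Proof.
move=> e0 ue.
have incr m n : (0 < m <= n)%N -> u m - e m <= u n - e n.
  move=> /andP[m0]; elim: n => [|n IH]; first by case: m m0.
  rewrite leq_eqVlt ltnS => /predU1P[->//|mn]; apply: le_trans (IH mn) _.
  by have := ue n (leq_trans m0 mn); rewrite ler_norml => /andP[]; lra.
have decr m n : (0 < m <= n)%N -> u n + e n <= u m + e m.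
  move=> /andP[m0]; elim: n => [|n IH]; first by case: m m0.
  rewrite leq_eqVlt ltnS => /predU1P[->//|mn]; apply: le_trans _ (IH mn).
  by have := ue n (leq_trans m0 mn); rewrite ler_norml => /andP[]; lra.
pose S : set R := [set u n - e n | n in [set n | (0 < n)%N]]%classic.
have cross m n : (0 < m)%N -> (0 < n)%N -> u m - e m <= u n + e n.
  move=> m0 n0; have h1 := incr m (maxn m n); have h2 := decr n (maxn m n).
  have h3 := e0 (maxn m n).
  rewrite leq_maxl m0 in h1; rewrite leq_maxr n0 in h2; rewrite leq_max m0 in h3.
  by have := h1 isT; have := h2 isT; have := h3 isT; lra.
have S0 : nonempty S by exists (u 1%N - e 1%N), 1%N.
exists (sup S) => n n0; rewrite ler_norml; apply/andP; split.
  rewrite lerBrDl -lerBrDr opprK; apply: ge_sup => // _ [m m0 <-].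
  exact: cross.
rewrite lerBlDr -lerBlDl; apply: sup_upper_bound; last by exists n.
by split=> //; exists (u 1%N + e 1%N) => _ [m m0 <-]; exact: cross.
Qed.

(** [gam] is Euler's constant. *)
Lemma harmonic_sum_asymp : exists gam : R, forall n, (0 < n)%N ->
  `|\sum_(1 <= k < n.+1) k%:R^-1 - ln n%:R - gam| <= n%:R^-1.
Proof.
apply: squeezed_limit => [n n0|n n0]; first by rewrite invr_ge0.
rewrite big_nat_recr//= ler_norml; have := lnS_sub_bounds n0.
set x := n.+1%:R^-1; set y := n%:R^-1 => /andP[h1 h2].
by apply/andP; split; lra.
Qed.

Lemma harmonic_sum_le n : (0 < n)%N -> \sum_(1 <= k < n.+1) k%:R^-1 <= 1 + ln n%:R :> R.
Proof.
elim: n => // n IH _; have [->|n0] := posnP n; first by rewrite big_nat1 invr1 ln1 addr0.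
rewrite big_nat_recr//=; have := lnS_sub_bounds n0.
set x := n.+1%:R^-1 => /andP[h1 h2].
by have := IH n0; lra.
Qed.

(** The bound is shaped so that its decrease from n to n + 1, about (ln n + 2) / n^2, dominates the
    change of the left side. *)
Lemma sum_ln_div_asymp : exists c : R, forall n, (0 < n)%N ->
  `|\sum_(1 <= k < n.+1) ln k%:R / k%:R - ln n%:R ^+ 2 / 2 - c| <= (ln n%:R + 3) / n%:R.
Proof.
apply: squeezed_limit => [n n0|n n0].
  by rewrite divr_ge0// addr_ge0// ln_nat_ge0.
rewrite big_nat_recr//=; have /andP[] := lnS_sub_bounds n0.
have := ln_nat_ge0 n.
set a := ln n%:R; set b := ln n.+1%:R; set x := n%:R^-1; set y := n.+1%:R^-1.
have y0 : 0 < y by rewrite invr_gt0 ltr0n.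
have xy : x - y = x * y.
  have n1 : n%:R != 0 :> R by rewrite pnatr_eq0 -lt0n.
  have n2 : n%:R + 1 != 0 :> R by rewrite natr1 pnatr_eq0.
  by rewrite /x /y -natr1; field; rewrite n1 n2.
have x1 : x <= 1 by rewrite invf_le1 ?ltr0n// ler1n.
rewrite ler_norml => a0 h1 h2; apply/andP; split; nra.
Qed.

End LogarithmicSums.

(** * Selberg's formula *)

Section SelbergFormula.
Variable R : realType.
Implicit Types (n k d K N : nat) (x y : R).
Local Notation mu := (mu R).
Local Notation Lam := (vonMangoldt R).
Local Notation Lam2 := (selbergLambda R).

Lemma conv_mu_log_one n : (0 < n)%N -> conv (fun d => mu d * ln d%:R) (fun=> 1) n = - Lam n.
Proof.
move=> n0; rewrite (eq_conv (@mu_log R) (fun=> fun=> erefl)) convNl convA.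
by rewrite (eq_conv (fun=> fun=> erefl) (@conv_mu_one R)) conv_unitr.
Qed.

Lemma conv_mu_log2_one n : (0 < n)%N ->
  conv (fun d => mu d * ln d%:R ^+ 2) (fun=> 1) n = Lam2 n - 2 * Lam n * ln n%:R.
Proof.
move=> n0; rewrite (eq_conv (@mu_log2 R) (fun=> fun=> erefl)) convA.
rewrite (eq_conv (fun=> fun=> erefl) (@conv_mu_one R)) conv_unitr// /selbergLambda.
by ring.
Qed.

Lemma sum_conv_one (f : nat -> R) N :
  \sum_(1 <= n < N.+1) conv f (fun=> 1) n = \sum_(1 <= d < N.+1) f d * (N %/ d)%:R.
Proof.
have := sum_conv f (fun=> 1) (fun=> 1) N; under eq_bigr do rewrite mulr1.
by move=> ->; apply: eq_bigr => d _; under eq_bigr do rewrite mulr1;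
  rewrite sumr_const_nat subn1/=.
Qed.

Lemma sum_conv_unit (w : nat -> R) N : (0 < N)%N ->
  \sum_(1 <= n < N.+1) conv mu (fun=> 1) n * w n = w 1%N.
Proof.
move=> N0; rewrite big_nat_recl//= conv_mu_one// /conv_unit eqxx mul1r.
rewrite big_nat big1 ?addr0// => n /andP[n0 _].
by rewrite conv_mu_one// /conv_unit; case: n n0 => //= n _; rewrite mul0r.
Qed.

Lemma sum_mu_multiples (w : nat -> R) N : (0 < N)%N ->
  \sum_(1 <= d < N.+1) mu d * \sum_(1 <= k < (N %/ d).+1) w (d * k)%N = w 1%N.
Proof.
move=> N0; rewrite -[RHS](sum_conv_unit w N0) sum_conv.
by apply: eq_bigr => d _; congr (_ * _); apply: eq_bigr => k _; rewrite mul1r.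
Qed.

Lemma sum_mu_approx (f g e : nat -> R) N :
  (forall d, (0 < d <= N)%N -> `|f d - g d| <= e d) ->
  `|\sum_(1 <= d < N.+1) mu d * f d - \sum_(1 <= d < N.+1) mu d * g d| <=
  \sum_(1 <= d < N.+1) e d.
Proof.
move=> fg; rewrite -sumrB; apply: le_trans (ler_norm_sum _ _ _) _.
apply: ler_sum_nat => d dN; rewrite -mulrBr normrM.
by rewrite -[leRHS]mul1r ler_pM// ?norm_mu_le1// fg.
Qed.

(** Moebius inversion with an error term: a function [w] whose sums over the multiples of d are
    known up to e(d) gives an estimate for a sum of mu(d) g(d). *)
Lemma sum_mu_multiples_approx (w g e : nat -> R) N : (0 < N)%N ->
  (forall d, (0 < d <= N)%N ->
     `|\sum_(1 <= k < (N %/ d).+1) w (d * k)%N - g d| <= e d) ->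
  `|w 1%N - \sum_(1 <= d < N.+1) mu d * g d| <= \sum_(1 <= d < N.+1) e d.
Proof. by move=> N0 wg; rewrite -(sum_mu_multiples w N0); exact: sum_mu_approx. Qed.

(** * Sums of mu(d) / d with powers of ln (N / d) *)

Lemma sum_const_le (C : R) N : \sum_(1 <= d < N.+1) C = C * N%:R.
Proof. by rewrite sumr_const_nat subn1/= mulr_natr. Qed.

(** With w = 1, the sum over multiples is the integer part of N / d, within 1 of N / d; so N times
    the sum differs from 1 by at most N. *)
Lemma norm_sum_mu_div N : `|\sum_(1 <= d < N.+1) mu d / d%:R| <= 2.
Proof.
have [->|N0] := posnP N; first by rewrite big_geq// normr0.
have := @sum_mu_multiples_approx (fun=> 1) (fun d => N%:R / d%:R) (fun=> 1) N N0.
move=> /=/(_ _)/wrap[d /(divn_bounds R)[_ _ h1 h2]|].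
  by rewrite sumr_const_nat subn1/= ler_norml; apply/andP; split; lra.
 rewrite sum_const_le mul1r.
under [X in _ - X]eq_bigr do rewrite mulrCA.
rewrite -mulr_sumr; set S := \sum_(_ <= _ < _) _.
have NR : 1 <= N%:R :> R by rewrite ler1n.
rewrite !ler_norml => /andP[h1 h2]; apply/andP; split; nra.
Qed.

(** In the applications y is N / d and K its integer part. *)
Lemma ln_sub_floor K y : (0 < K)%N -> K%:R <= y <= K%:R + 1 ->
  0 <= ln y - ln K%:R <= K%:R^-1.
Proof.
move=> K0 /andP[Ky yK]; have KR : 0 < K%:R :> R by rewrite ltr0n.
rewrite subr_ge0 ler_ln ?posrE// ?Ky/=; last lra.
apply: le_trans (ln_sub_le _ _) _ => //; first lra.
by rewrite ler_pdivrMr// mulVf ?gt_eqF//; lra.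
Qed.

Lemma harmonic_sum_floor : exists gam : R, forall K y, (0 < K)%N ->
  K%:R <= y <= K%:R + 1 ->
  `|\sum_(1 <= k < K.+1) k%:R^-1 - (ln y + gam)| <= 2 / K%:R.
Proof.
have [gam H] := harmonic_sum_asymp R; exists gam => K y K0 Ky.
have := H K K0; have := ln_sub_floor K0 Ky.
set x := K%:R^-1; set S := \sum_(_ <= _ < _) _; set a := ln y; set b := ln _.
rewrite !ler_norml => /andP[? ?] /andP[? ?]; apply/andP; split; lra.
Qed.

Lemma sum_div_ln_floor : exists gam c : R, forall K y, (0 < K)%N ->
  K%:R <= y <= K%:R + 1 ->
  `|\sum_(1 <= k < K.+1) (ln y - ln k%:R) / k%:R - (ln y ^+ 2 / 2 + gam * ln y - c)|
  <= (2 * ln y + 4) / K%:R.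
Proof.
have [gam H] := harmonic_sum_asymp R; have [c A] := sum_ln_div_asymp R.
exists gam, c => K y K0 Ky.
have -> : \sum_(1 <= k < K.+1) (ln y - ln k%:R) / k%:R =
    ln y * \sum_(1 <= k < K.+1) k%:R^-1 - \sum_(1 <= k < K.+1) ln k%:R / k%:R.
  by rewrite mulr_sumr -sumrB; apply: eq_bigr => k _; rewrite mulrBl.
have x0 : 0 < K%:R^-1 :> R by rewrite invr_gt0 ltr0n.
have x1 : K%:R^-1 <= 1 :> R by rewrite invf_le1 ?ltr0n// ler1n.
have := H K K0; have := A K K0; have := ln_sub_floor K0 Ky; have := ln_nat_ge0 R K.
move: x0 x1; set x := K%:R^-1; set a := ln y; set b := ln _.
set S := \sum_(_ <= _ < _) _; set T := \sum_(_ <= _ < _) _.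
rewrite !ler_norml => x0 x1 b0 /andP[ab1 ab2] /andP[T1 T2] /andP[S1 S2].
have a0 : 0 <= a by lra.
have aS1 : - (a * x) <= a * (T - b - gam) by rewrite -mulrN ler_wpM2l.
have aS2 : a * (T - b - gam) <= a * x by rewrite ler_wpM2l.
(* Since a b - b^2 / 2 = a^2 / 2 - (a - b)^2 / 2, passing from b = ln K to a = ln y costs at most
   half of this bound. *)
have e1 : (a - b) ^+ 2 <= x by nra.
have e0 : 0 <= (a - b) ^+ 2 by apply: sqr_ge0.
have bx : b * x <= a * x by nra.
apply/andP; split; nra.
Qed.

(* Moebius inversion of the function [x], evaluated at [N]. *)
Lemma sum_mu_div_ln_bounded : exists2 C : R, 0 <= C & forall N,
  `|\sum_(1 <= d < N.+1) mu d / d%:R * ln (N%:R / d%:R)| <= C.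
Proof.
have [gam H] := harmonic_sum_floor; exists (5 + 2 * `|gam|) => [|N].
  by rewrite addr_ge0// mulr_ge0.
have [->|N0] := posnP N; first by rewrite big_geq// normr0 addr_ge0// mulr_ge0.
have := @sum_mu_multiples_approx (fun n => N%:R / n%:R)
  (fun d => N%:R / d%:R * (ln (N%:R / d%:R) + gam)) (fun=> 4) N N0.
move=> /=/(_ _)/wrap[d dN|].
  have [K0 KR h1 h2] := divn_bounds R dN.
  have := H _ (N%:R / d%:R) K0; rewrite h1 h2 => /(_ isT) h.
  under eq_bigr do rewrite natrM invfM mulrA.
  rewrite -mulr_sumr -mulrBr normrM ger0_norm; last lra.
  apply: le_trans (ler_wpM2l _ h) _; first lra.
  (* The error 4 arises because N / d <= K + 1 <= 2 K multiplies the error 2 / K. *)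
  rewrite mulrA ler_pdivrMr//; have : 1 <= (N %/ d)%:R :> R by rewrite ler1n.
  lra.
rewrite sum_const_le divr1.
have -> : \sum_(1 <= d < N.+1) mu d * (N%:R / d%:R * (ln (N%:R / d%:R) + gam)) =
  N%:R * (\sum_(1 <= d < N.+1) mu d / d%:R * ln (N%:R / d%:R) +
          gam * \sum_(1 <= d < N.+1) mu d / d%:R).
  rewrite mulrDr !mulr_sumr -big_split; apply: eq_bigr => d _ /=; ring.
have := norm_sum_mu_div N.
set S := \sum_(_ <= _ < _) _; set T := \sum_(_ <= _ < _) _ => S2.
have -> : N%:R - N%:R * (T + gam * S) = N%:R * (1 - (T + gam * S)) by ring.
have NR : 0 < N%:R :> R by rewrite ltr0n.
rewrite normrM gtr0_norm// [4 * _]mulrC ler_pM2l// => h.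
have gS : `|gam * S| <= 2 * `|gam| by rewrite normrM mulrC ler_wpM2r.
move: h gS; rewrite !ler_norml => /andP[? ?] /andP[? ?]; apply/andP; split; lra.
Qed.

(* Moebius inversion of the function [x * ln x], evaluated at [N]. *)
Lemma sum_mu_div_ln2_asymp : exists2 C : R, 0 <= C & forall N,
  `|\sum_(1 <= d < N.+1) mu d / d%:R * ln (N%:R / d%:R) ^+ 2 - 2 * ln N%:R| <= C.
Proof.
have [gam [c H]] := sum_div_ln_floor; have [C1 C10 H1] := sum_ln_pow R 1.
have [C4 C40 H4] := sum_mu_div_ln_bounded.
(* After division by N, half the sum is ln N up to 4 C1 + 8 from the pointwise errors, |gam| C4 from
   the sum with one logarithm, and 2 |c| from the sum of mu(d) / d. *)
set C := 2 * (4 * C1 + 8 + `|gam| * C4 + 2 * `|c|).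
have C0 : 0 <= C by rewrite /C !(mulr_ge0, addr_ge0).
exists C => // N.
have [->|N0] := posnP N; first by rewrite big_geq// ln0// mulr0 subr0 normr0.
have := @sum_mu_multiples_approx (fun n => N%:R / n%:R * ln (N%:R / n%:R))
  (fun d => N%:R / d%:R * (ln (N%:R / d%:R) ^+ 2 / 2 + gam * ln (N%:R / d%:R) - c))
  (fun d => 4 * ln (N%:R / d%:R) ^+ 1 + 8) N N0.
move=> /=/(_ _)/wrap[d dN|].
  have [K0 KR h1 h2] := divn_bounds R dN.
  have := H _ (N%:R / d%:R) K0; rewrite h1 h2 => /(_ isT) h.
  have y0 : 0 < N%:R / d%:R :> R by lra.
  have -> : \sum_(1 <= k < (N %/ d).+1) (N%:R / (d * k)%:R * ln (N%:R / (d * k)%:R)) =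
     N%:R / d%:R * \sum_(1 <= k < (N %/ d).+1) (ln (N%:R / d%:R) - ln k%:R) / k%:R :> R.
    rewrite mulr_sumr; apply: eq_big_nat => k /andP[k0 _].
    by rewrite natrM invfM !mulrA ln_div ?posrE// ?ltr0n//; ring.
  rewrite -mulrBr normrM gtr0_norm//.
  apply: le_trans (ler_wpM2l (ltW y0) h) _.
  rewrite mulrA ler_pdivrMr//; have : 1 <= (N %/ d)%:R :> R by rewrite ler1n.
  have := ln_div_nat_ge0 R (andP dN).2; rewrite expr1.
  nra.
rewrite big_split/= -mulr_sumr sum_const_le !divr1.
have -> : \sum_(1 <= d < N.+1) mu d * (N%:R / d%:R *
    (ln (N%:R / d%:R) ^+ 2 / 2 + gam * ln (N%:R / d%:R) - c)) =
  N%:R * ((\sum_(1 <= d < N.+1) mu d / d%:R * ln (N%:R / d%:R) ^+ 2) / 2 +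
          gam * (\sum_(1 <= d < N.+1) mu d / d%:R * ln (N%:R / d%:R)) -
          c * \sum_(1 <= d < N.+1) mu d / d%:R).
  rewrite mulrBr mulrDr mulr_suml !mulr_sumr -big_split -sumrB; apply: eq_bigr => d _ /=.
  by ring.
have := norm_sum_mu_div N; have := H4 N; have := H1 N.
set L := \sum_(_ <= _ < _) ln _ ^+ 1.
set S := \sum_(_ <= _ < _) (_ / _); set T := \sum_(_ <= _ < _) (_ / _ * ln _).
set U := \sum_(_ <= _ < _) _ => HL HT HS.
have -> : N%:R * ln N%:R - N%:R * (U / 2 + gam * T - c * S) =
  N%:R * (ln N%:R - (U / 2 + gam * T - c * S)) by ring.
have NR : 0 < N%:R :> R by rewrite ltr0n.
rewrite normrM gtr0_norm// => h.
have h' : N%:R * `|ln N%:R - (U / 2 + gam * T - c * S)| <= N%:R * (4 * C1 + 8) by lra.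
rewrite ler_pM2l// in h'.
have gT : `|gam * T| <= `|gam| * C4 by rewrite normrM ler_wpM2l.
have cS : `|c * S| <= 2 * `|c| by rewrite normrM mulrC ler_wpM2r.
move: h' gT cS; rewrite /C !ler_norml => /andP[? ?] /andP[? ?] /andP[? ?].
by apply/andP; split; lra.
Qed.

(** Replacing the integer part of N / d by N / d costs at most ln^k (N / d) in each term, and these
    add up to O(N) by [sum_ln_pow]. *)
Lemma sum_mu_ln_floor k : exists2 C : R, 0 <= C & forall N,
  `|\sum_(1 <= d < N.+1) mu d * ln (N%:R / d%:R) ^+ k * (N %/ d)%:R -
    N%:R * \sum_(1 <= d < N.+1) mu d / d%:R * ln (N%:R / d%:R) ^+ k| <= C * N%:R.
Proof.
have [C C0 H] := sum_ln_pow R k; exists C => // N; apply: le_trans (H N).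
have := @sum_mu_approx (fun d => ln (N%:R / d%:R) ^+ k * (N %/ d)%:R)
  (fun d => ln (N%:R / d%:R) ^+ k * (N%:R / d%:R)) (fun d => ln (N%:R / d%:R) ^+ k) N.
move=> /=/(_ _)/wrap[d dN|].
  have [_ _ h1 h2] := divn_bounds R dN.
  have l0 : 0 <= ln (N%:R / d%:R) ^+ k :> R by rewrite exprn_ge0 ?ln_div_nat_ge0//; case/andP: dN.
  rewrite -mulrBr normrM ger0_norm// -[leRHS]mulr1 ler_wpM2l// ler_norml.
  by apply/andP; split; lra.
rewrite mulr_sumr; congr (`|_ - _| <= _); apply: eq_bigr => d _; ring.
Qed.

(** * Chebyshev's bound and Selberg's formula *)

Definition psi N := \sum_(1 <= n < N.+1) Lam n.

Lemma psi_ge0 N : 0 <= psi N.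
Proof. by apply: sumr_ge0 => n _; apply: vonMangoldt_ge0. Qed.

(** The sum of mu(d) ln (N / d) times the integer part of N / d equals ln N + psi(N), and it is O(N)
    by [sum_mu_ln_floor] and [sum_mu_div_ln_bounded]. *)
Lemma psi_le : exists2 C : R, 0 <= C & forall N, psi N <= C * N%:R.
Proof.
have [C C0 H] := sum_mu_ln_floor 1; have [C4 C40 H4] := sum_mu_div_ln_bounded.
exists (C + C4) => [|N]; first by rewrite addr_ge0.
have [->|N0] := posnP N; first by rewrite /psi big_geq// mulr0.
have := H N.
have -> : \sum_(1 <= d < N.+1) mu d * ln (N%:R / d%:R) ^+ 1 * (N %/ d)%:R =
  ln N%:R * \sum_(1 <= n < N.+1) conv mu (fun=> 1) n * 1 -
  \sum_(1 <= n < N.+1) conv (fun d => mu d * ln d%:R) (fun=> 1) n.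
  under [X in _ * X - _]eq_bigr do rewrite mulr1.
  rewrite !sum_conv_one mulr_sumr -sumrB; apply: eq_big_nat => d /andP[d0 _].
  by rewrite expr1 ln_div_nat//; ring.
rewrite (sum_conv_unit (fun=> 1) N0)/= mulr1.
rewrite [X in _ - X - _](_ : _ = - psi N); last first.
  by rewrite /psi -sumrN; apply: eq_big_nat => n /andP[n0 _]; rewrite conv_mu_log_one.
have := H4 N; under [X in _ - N%:R * X]eq_bigr do rewrite expr1.
set T := \sum_(_ <= _ < _) _; have := ln_nat_ge0 R N.
have NR : 0 < N%:R :> R by rewrite ltr0n.
rewrite !ler_norml => l0 /andP[? ?] /andP[? ?]; nra.
Qed.

(** From N to N + 1 the sum grows by psi(N) (ln (N + 1) - ln N), which is bounded. *)
Lemma sum_vonMangoldt_ln_le : exists2 C : R, 0 <= C & forall N,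
  \sum_(1 <= n < N.+1) Lam n * ln (N%:R / n%:R) <= C * N%:R.
Proof.
have [C C0 H] := psi_le; exists C => //; elim=> [|N IH]; first by rewrite big_geq// mulr0.
rewrite big_nat_recr//= divff ?pnatr_eq0// ln1 mulr0 addr0.
have [->|N0] := posnP N; first by rewrite big_geq// mulr1.
have -> : \sum_(1 <= n < N.+1) Lam n * ln (N.+1%:R / n%:R) =
  \sum_(1 <= n < N.+1) Lam n * ln (N%:R / n%:R) + psi N * (ln N.+1%:R - ln N%:R).
  rewrite mulr_suml -big_split; apply: eq_big_nat => n /andP[n0 _] /=.
  by rewrite !ln_div_nat//; ring.
rewrite -[in leRHS](natr1 N) [leRHS]mulrDr mulr1 lerD//.
have NR : 0 < N%:R :> R by rewrite ltr0n.
have /andP[_ h] := lnS_sub_bounds R N0.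
apply: le_trans (ler_wpM2l (psi_ge0 N) h) _.
by rewrite ler_pdivrMr.
Qed.

Definition selberg_psi N := \sum_(1 <= n < N.+1) Lam2 n.

(* Selberg's trick: sum [mu d * ln (N / d) ^+ 2] over the divisors of [n], then over [n <= N],
   and expand [ln (N / d) = ln N - ln d]. *)
Lemma selberg_formula : exists2 C : R, 0 <= C & forall N,
  `|selberg_psi N - 2 * N%:R * ln N%:R| <= C * N%:R.
Proof.
have [C C0 H] := sum_mu_ln_floor 2; have [C5 C50 H5] := sum_mu_div_ln2_asymp.
have [C6 C60 H6] := sum_vonMangoldt_ln_le; have [C7 C70 H7] := sum_ln_pow R 2.
exists (C + C5 + 2 * C6 + C7) => [|N]; first by rewrite !(addr_ge0, mulr_ge0).
have [->|N0] := posnP N.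
  by rewrite /selberg_psi big_geq// !mulr0 mul0r subr0 normr0.
have := H N.
have -> : \sum_(1 <= d < N.+1) mu d * ln (N%:R / d%:R) ^+ 2 * (N %/ d)%:R =
  ln N%:R ^+ 2 * \sum_(1 <= n < N.+1) conv mu (fun=> 1) n * 1 -
  2 * ln N%:R * (\sum_(1 <= n < N.+1) conv (fun d => mu d * ln d%:R) (fun=> 1) n) +
  \sum_(1 <= n < N.+1) conv (fun d => mu d * ln d%:R ^+ 2) (fun=> 1) n.
  under [X in _ * X - _]eq_bigr do rewrite mulr1.
  rewrite !sum_conv_one !mulr_sumr -sumrB -big_split; apply: eq_big_nat => d /andP[d0 _] /=.
  by rewrite ln_div_nat//; ring.
rewrite (sum_conv_unit (fun=> 1) N0)/= mulr1.
(* The terms 2 Lambda(n) ln N and - 2 Lambda(n) ln n combine to 2 Lambda(n) ln (N / n), of total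
   size O(N). *)
have -> : ln N%:R ^+ 2 -
  2 * ln N%:R * (\sum_(1 <= n < N.+1) conv (fun d => mu d * ln d%:R) (fun=> 1) n) +
  \sum_(1 <= n < N.+1) conv (fun d => mu d * ln d%:R ^+ 2) (fun=> 1) n =
  ln N%:R ^+ 2 + 2 * (\sum_(1 <= n < N.+1) Lam n * ln (N%:R / n%:R)) + selberg_psi N.
  rewrite -addrA -[RHS]addrA; congr (_ + _).
  rewrite /selberg_psi !mulr_sumr -sumrN -!big_split; apply: eq_big_nat => n /andP[n0 _] /=.
  by rewrite conv_mu_log_one// conv_mu_log2_one// ln_div_nat//; ring.
(* ln^2 N is the term d = 1 of a sum of nonnegative terms known to be O(N). *)
have h7 : ln N%:R ^+ 2 <= C7 * N%:R.
  apply: le_trans (H7 N); rewrite big_nat_recl//= divr1 lerDl.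
  by apply: sumr_ge0 => n _; apply: sqr_ge0.
have S0 : 0 <= \sum_(1 <= n < N.+1) Lam n * ln (N%:R / n%:R).
  rewrite big_nat; apply: sumr_ge0 => n /andP[_ nN].
  by rewrite mulr_ge0 ?vonMangoldt_ge0// ln_div_nat_ge0// -ltnS.
have := H5 N; have := H6 N.
move: S0; set S := \sum_(_ <= _ < _) _; set U := \sum_(_ <= _ < _) _.
have NR : 0 < N%:R :> R by rewrite ltr0n.
rewrite !ler_norml => S0 h6 /andP[h51 h52] /andP[h1 h2].
have lq : 0 <= ln N%:R ^+ 2 :> R by apply: sqr_ge0.
have := ler_wpM2l (ltW NR) h51; have := ler_wpM2l (ltW NR) h52.
have : 0 <= C7 * N%:R by rewrite mulr_ge0.
by move: h6 h7; rewrite !mulrDl => *; apply/andP; split; lra.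
Qed.

(** N / n is at most twice its integer part, and the sum of Lambda(n) times that integer part is the
    logarithm of N!, at most N ln N. *)
Lemma sum_vonMangoldt_div_le N : (0 < N)%N ->
  \sum_(1 <= n < N.+1) Lam n / n%:R <= 2 * ln N%:R.
Proof.
move=> N0; have NR : 0 < N%:R :> R by rewrite ltr0n.
rewrite -(ler_pM2l NR) mulr_sumr.
have h : \sum_(1 <= n < N.+1) ln n%:R <= N%:R * ln N%:R :> R.
  rewrite mulrC -sum_const_le; apply: ler_sum_nat => n /andP[n0 nN].
  by rewrite ler_ln ?posrE ?ltr0n// ler_nat -ltnS.
have hE : \sum_(1 <= n < N.+1) Lam n * (N %/ n)%:R = \sum_(1 <= n < N.+1) ln n%:R.
  rewrite -sum_conv_one; apply: eq_big_nat => n /andP[n0 _].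
  by rewrite conv_vonMangoldt_one.
apply: (@le_trans _ _ (2 * \sum_(1 <= n < N.+1) Lam n * (N %/ n)%:R)); last by rewrite hE; lra.
rewrite mulr_sumr; apply: ler_sum_nat => n nN.
have [K0 _ h1 h2] := divn_bounds R nN.
have K1 : 1 <= (N %/ n)%:R :> R by rewrite ler1n.
have := vonMangoldt_ge0 R n; rewrite mulrCA.
set y := N%:R / n%:R in h1 h2 *; nra.
Qed.

End SelbergFormula.

(** * The sum of mu(n) ln(N/n) *)

Section MoebiusLogSum.
Variable R : realType.
Implicit Types (n k d m K N : nat) (x y : R).
Local Notation mu := (mu R).
Local Notation Lam := (vonMangoldt R).
Local Notation Lam2 := (selbergLambda R).

Definition mertens N := \sum_(1 <= n < N.+1) mu n.

(* The restriction of [moebius_log_sum] to the integers; the [F] of the header. *)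
Definition mulog N := \sum_(1 <= n < N.+1) mu n * ln (N%:R / n%:R).

Lemma mertens_bound N : `|mertens N| <= N%:R.
Proof.
apply: le_trans (ler_norm_sum _ _ _) _; rewrite -[leRHS]mul1r -sum_const_le.
by apply: ler_sum_nat => n _; exact: norm_mu_le1.
Qed.

Lemma sum_mu_ln y N : 0 < y ->
  \sum_(1 <= n < N.+1) mu n * ln (y / n%:R) =
  mulog N + mertens N * (ln y - ln N%:R).
Proof.
move=> y0; rewrite /mulog /mertens mulr_suml -big_split; apply: eq_big_nat => n /andP[n0 nN] /=.
have N0 : (0 < N)%N by lia.
by rewrite ln_div_nat// ln_div ?posrE ?ltr0n//; ring.
Qed.

Lemma mulog0 : mulog 0 = 0.
Proof. by rewrite /mulog big_geq. Qed.

Lemma mulogS N : mulog N.+1 = mulog N + mertens N * (ln N.+1%:R - ln N%:R).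
Proof.
rewrite /mulog big_nat_recr//= divff ?pnatr_eq0// ln1 mulr0 addr0.
by rewrite sum_mu_ln// ltr0n.
Qed.

Lemma norm_mertens_mul (e : R) N : (0 < N)%N -> 0 <= e <= N%:R^-1 ->
  `|mertens N * e| <= 1.
Proof.
move=> N0 /andP[e0 eN]; rewrite normrM (ger0_norm e0).
have h := ler_pM (normr_ge0 _) e0 (mertens_bound N) eN.
by apply: le_trans h _; rewrite divff// pnatr_eq0 -lt0n.
Qed.

Lemma mulog_lipschitz N : `|mulog N.+1 - mulog N| <= 1.
Proof.
rewrite mulogS addrC addKr; have [->|N0] := posnP N.
  by rewrite /mertens big_geq// mul0r normr0.
apply: norm_mertens_mul => //; have /andP[h1 ->] := lnS_sub_bounds R N0.
by rewrite andbT; apply: le_trans h1; rewrite invr_ge0.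
Qed.

Lemma mulog_bound N : `|mulog N| <= N%:R.
Proof.
elim: N => [|N IH]; first by rewrite mulog0 normr0.
have := mulog_lipschitz N; move: IH; rewrite -natr1 !ler_norml => /andP[? ?] /andP[? ?].
by apply/andP; split; lra.
Qed.

Lemma mulog_floor K y : (0 < K)%N -> K%:R <= y <= K%:R + 1 ->
  `|\sum_(1 <= k < K.+1) mu k * ln (y / k%:R) - mulog K| <= 1.
Proof.
move=> K0 Ky; have KR : 0 < K%:R :> R by rewrite ltr0n.
have y0 : 0 < y by case/andP: Ky => h _; apply: lt_le_trans h.
by rewrite sum_mu_ln// addrC addKr; apply: norm_mertens_mul => //; exact: ln_sub_floor.
Qed.

(** * Selberg's inequality for F *)

Lemma sum_ln2_floor : exists2 C : R, 0 <= C & forall K y, (0 < K)%N ->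
  K%:R <= y <= K%:R + 1 -> \sum_(1 <= k < K.+1) ln (y / k%:R) ^+ 2 <= C * K%:R.
Proof.
have [C C0 H] := sum_ln_pow R 2; exists (2 * C + 2) => [|K y K0 Ky].
  by rewrite addr_ge0// mulr_ge0.
have KR : 0 < K%:R :> R by rewrite ltr0n.
have y0 : 0 < y by case/andP: Ky => h _; apply: lt_le_trans h.
(* ln (y / k) exceeds ln (K / k) by at most 1, and (u + v)^2 <= 2 u^2 + 2 v^2. *)
apply: (@le_trans _ _ (\sum_(1 <= k < K.+1) (2 * ln (K%:R / k%:R) ^+ 2 + 2))).
  apply: ler_sum_nat => k /andP[k0 kK]; have /andP[h1 h2] := ln_sub_floor K0 Ky.
  have x1 : K%:R^-1 <= 1 :> R by rewrite invf_le1 ?ltr0n// ler1n.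
  rewrite ln_div_nat// ln_div ?posrE ?ltr0n//.
  move: h1 h2 x1; set a := ln y; set b := ln K%:R; set c := ln k%:R.
  move=> h1 h2 x1; have := sqr_ge0 (b - c - (a - b)).
  have : (a - b) ^+ 2 <= 1 by rewrite expr_le1//; lra.
  by rewrite !expr2; lra.
rewrite big_split/= -mulr_sumr sum_const_le; have := H K; lra.
Qed.

Lemma selberg_psi_le : exists2 C : R, 0 <= C & forall N, (0 < N)%N ->
  selberg_psi R N <= C * N%:R * (1 + ln N%:R).
Proof.
have [C C0 H] := selberg_formula R; exists (C + 2) => [|N N0]; first by rewrite addr_ge0.
have := H N; rewrite ler_norml => /andP[_]; have l0 := ln_nat_ge0 R N.
have : 0 <= C * N%:R * ln N%:R by rewrite !mulr_ge0.
have : 0 <= N%:R :> R by [].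
lra.
Qed.

(* With [y = ln (N / n)], [l = ln n] and [ln N = y + l], expand
   [y * ln N ^+ 2 = y ^+ 3 + 2 * l * y ^+ 2 + l ^+ 2 * y]; the factors [mu n * l] and
   [mu n * l ^+ 2] are convolutions with [mu], and only the last term is not
   [O(N * (1 + ln N))]. *)
Lemma mulog_ln2_le : exists2 C : R, 0 <= C & forall N, (0 < N)%N ->
  `|mulog N| * ln N%:R ^+ 2 <=
  \sum_(1 <= d < N.+1) Lam2 d * `|mulog (N %/ d)| + C * N%:R * (1 + ln N%:R).
Proof.
have [C3 C30 H3] := sum_ln_pow R 3; have [C2 C20 H2] := sum_ln2_floor.
have [CS CS0 HS] := selberg_psi_le.
exists (C3 + 4 * C2 + CS) => [|N N0]; first by rewrite !(addr_ge0, mulr_ge0).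
have NR : 0 < N%:R :> R by rewrite ltr0n.
have L0 := ln_nat_ge0 R N.
pose T1 := \sum_(1 <= n < N.+1) mu n * ln (N%:R / n%:R) ^+ 3.
pose T2 := \sum_(1 <= n < N.+1) conv Lam mu n * ln (N%:R / n%:R) ^+ 2.
pose w d := conv Lam Lam d - Lam d * ln d%:R.
pose T3 := \sum_(1 <= n < N.+1) conv w mu n * ln (N%:R / n%:R).
have E : mulog N * ln N%:R ^+ 2 = T1 - 2 * T2 + T3.
  rewrite /T2 mulr_sumr -sumrB -big_split mulr_suml; apply: eq_big_nat => n /andP[n0 _] /=.
  rewrite -[conv Lam mu n]opprK -mu_log// -mu_log2// ln_div_nat//; ring.
have h1 : `|T1| <= C3 * N%:R.
  apply: le_trans (ler_norm_sum _ _ _) (le_trans _ (H3 N)).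
  apply: ler_sum_nat => n /andP[n0 nN]; rewrite normrM.
  have l0 : 0 <= ln (N%:R / n%:R) ^+ 3 :> R by rewrite exprn_ge0// ln_div_nat_ge0.
  by rewrite (ger0_norm l0) ler_piMl// norm_mu_le1.
(* The inner sums over k are O(N / d), and the sum of Lambda(d) / d is O(ln N). *)
have h2 : `|T2| <= C2 * N%:R * (2 * ln N%:R).
  have hl : C2 * N%:R * \sum_(1 <= d < N.+1) Lam d / d%:R <= C2 * N%:R * (2 * ln N%:R).
    by rewrite ler_wpM2l ?mulr_ge0// sum_vonMangoldt_div_le.
  apply: le_trans hl; rewrite /T2 sum_conv mulr_sumr.
  apply: le_trans (ler_norm_sum _ _ _) _; apply: ler_sum_nat => d dN.
  have [K0 KR g1 g2] := divn_bounds R dN.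
  rewrite normrM ger0_norm ?vonMangoldt_ge0// mulrCA ler_wpM2l ?vonMangoldt_ge0//.
  apply: (@le_trans _ _ (C2 * (N %/ d)%:R)); last by rewrite -mulrA ler_wpM2l.
  have := H2 _ (N%:R / d%:R) K0; rewrite g1 g2 => /(_ isT); apply: le_trans.
  apply: le_trans (ler_norm_sum _ _ _) _; apply: ler_sum_nat => k _.
  rewrite normrM natrM invfM mulrA (ger0_norm (sqr_ge0 _)).
  by rewrite ler_piMl ?sqr_ge0// norm_mu_le1.
(* [w] is dominated by [Lam2], and the inner sum is F at the integer part of N / d up to 1; these
   errors add up to [selberg_psi R N]. *)
have h3 : `|T3| <= \sum_(1 <= d < N.+1) Lam2 d * `|mulog (N %/ d)| + selberg_psi R N.
  rewrite /T3 sum_conv /selberg_psi -big_split.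
  apply: le_trans (ler_norm_sum _ _ _) _; apply: ler_sum_nat => d dN /=.
  have [K0 KR g1 g2] := divn_bounds R dN.
  have := @mulog_floor _ (N%:R / d%:R) K0; rewrite g1 g2 => /(_ isT) g.
  rewrite normrM -[X in _ + X]mulr1 -mulrDr ler_pM//.
    have c0 : 0 <= conv Lam Lam d by apply: sumr_ge0 => e _; rewrite mulr_ge0 ?vonMangoldt_ge0.
    have l0 : 0 <= Lam d * ln d%:R by rewrite mulr_ge0 ?vonMangoldt_ge0 ?ln_nat_ge0.
    by rewrite /w /selbergLambda ler_norml; apply/andP; split; lra.
  under eq_bigr do rewrite natrM invfM mulrA.
  rewrite -[X in `|X| <= _](subrK (mulog (N %/ d))); apply: le_trans (ler_normD _ _) _.
  by rewrite addrC lerD2l.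
have hS := HS N N0.
rewrite -[ln N%:R ^+ 2]ger0_norm ?sqr_ge0// -normrM E.
have : 0 <= C3 * N%:R * ln N%:R by rewrite !mulr_ge0.
have : 0 <= C2 * N%:R by rewrite !mulr_ge0.
move: h1 h2 h3; rewrite !ler_norml => /andP[? ?] /andP[? ?] /andP[? ?] ? ?.
by apply/andP; split; lra.
Qed.

(** * From Selberg's formula to the logarithmic mean of F *)

Lemma abel_sum (G t : nat -> R) N : G 0%N = 0 ->
  \sum_(1 <= m < N.+1) (G m - G m.-1) * t m =
  G N * t N + \sum_(1 <= m < N) G m * (t m - t m.+1).
Proof.
move=> G0; elim: N => [|N IH]; first by rewrite !big_geq// G0 mul0r addr0.
rewrite big_nat_recr//= IH; have [->|N0] := posnP N.
  by rewrite !big_geq// G0; ring.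
by rewrite [in RHS]big_nat_recr//=; ring.
Qed.

(** Both sides run over the pairs with d k <= N. *)
Lemma sum_floor_swap (a g : nat -> R) N :
  \sum_(1 <= d < N.+1) a d * \sum_(1 <= k < (N %/ d).+1) g k =
  \sum_(1 <= k < N.+1) g k * \sum_(1 <= d < (N %/ k).+1) a d.
Proof.
have E (f h : nat -> R) : \sum_(1 <= d < N.+1) f d * \sum_(1 <= k < (N %/ d).+1) h k =
    \sum_(1 <= n < N.+1) conv f h n.
  transitivity (\sum_(1 <= n < N.+1) conv f h n * (fun=> 1) n).
    rewrite sum_conv; apply: eq_bigr => d _; congr (_ * _).
    by apply: eq_bigr => k _; rewrite mulr1.
  by apply: eq_bigr => n _; rewrite mulr1.
by rewrite !E; apply: eq_bigr => n _; rewrite convC.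
Qed.

Lemma selberg_psi_floor : exists2 C : R, 0 <= C & forall K y, (0 < K)%N ->
  K%:R <= y <= K%:R + 1 -> `|selberg_psi R K - 2 * y * ln y| <= C * y.
Proof.
have [C C0 H] := selberg_formula R; exists (C + 4) => [|K y K0 Ky]; first by rewrite addr_ge0.
have KR : 1 <= K%:R :> R by rewrite ler1n.
have /andP[h1 h2] := ln_sub_floor K0 Ky; have := H K; case/andP: Ky => Ky yK.
have y0 : 0 < y by lra.
have l0 := ln_nat_ge0 R K.
have ly := ltW (ln_sublinear y0).
have k2 : K%:R * (ln y - ln K%:R) <= 1.
  apply: le_trans (ler_wpM2l _ h2) _ => //.
  by rewrite divff// gt_eqF//; lra.
have k1 : 0 <= K%:R * (ln y - ln K%:R) by rewrite mulr_ge0//; lra.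
have k3 : (y - K%:R) * ln y <= y by rewrite -[leRHS]mul1r ler_pM//; lra.
have k4 : 0 <= (y - K%:R) * ln y by rewrite mulr_ge0//; lra.
have k5 : C * K%:R <= C * y by rewrite ler_wpM2l.
rewrite !ler_norml => /andP[? ?]; apply/andP; split; lra.
Qed.

(** The logarithmic mean of |F(m)| / m before division by ln N. The weight equals 1 / m - 1 / (m +
    1), which suits summation by parts. *)
Definition logmean N := \sum_(1 <= m < N.+1) `|mulog m| / (m * m.+1)%:R.

Lemma recip_mulS m : (0 < m)%N -> (m * m.+1)%:R^-1 = m%:R^-1 - m.+1%:R^-1 :> R.
Proof.
move=> m0; have n1 : m%:R != 0 :> R by rewrite pnatr_eq0 -lt0n.
have n2 : m%:R + 1 != 0 :> R by rewrite natr1 pnatr_eq0.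
by rewrite natrM -natr1; field; rewrite n1 n2.
Qed.

(** |F| is written as the sum of its increments [g], which are bounded by 1. Exchanging sums brings
    in [selberg_psi] at N / m, replaced by 2 (N / m) ln (N / m) with total error O(N (1 + ln N));
    summation by parts then restores |F|. *)
Lemma sum_selbergLambda_mulog_le : exists2 C : R, 0 <= C & forall N, (0 < N)%N ->
  \sum_(1 <= d < N.+1) Lam2 d * `|mulog (N %/ d)| <=
  2 * N%:R * \sum_(1 <= m < N) `|mulog m| / (m * m.+1)%:R * ln (N%:R / m%:R) +
  C * N%:R * (1 + ln N%:R).
Proof.
have [C C0 H] := selberg_psi_floor; exists (C + 2) => [|N N0]; first by rewrite addr_ge0.
have NR : 0 < N%:R :> R by rewrite ltr0n.
have hN : \sum_(1 <= m < N.+1) N%:R / m%:R <= N%:R * (1 + ln N%:R) :> R.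
  by rewrite -mulr_sumr ler_wpM2l// harmonic_sum_le.
pose G m := `|mulog m|; pose g m := G m - G m.-1.
have G0 : G 0%N = 0 by rewrite /G mulog0 normr0.
have g1 m : (0 < m)%N -> `|g m| <= 1.
  case: m => // m _; apply: le_trans (ler_dist_dist _ _) (mulog_lipschitz m).
pose t m := N%:R / m%:R * ln (N%:R / m%:R) : R.
have -> : \sum_(1 <= d < N.+1) Lam2 d * G (N %/ d)%N =
    \sum_(1 <= m < N.+1) g m * selberg_psi R (N %/ m).
  rewrite -sum_floor_swap; apply: eq_bigr => d _; congr (_ * _).
  have := abel_sum (fun=> 1) (N %/ d) G0; under eq_bigr do rewrite mulr1.
  by move=> ->; rewrite mulr1 big1 ?addr0// => m _; rewrite subrr mulr0.
have h1 : \sum_(1 <= m < N.+1) g m * selberg_psi R (N %/ m) <=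
    \sum_(1 <= m < N.+1) g m * (2 * t m) + \sum_(1 <= m < N.+1) C * (N%:R / m%:R).
  rewrite -big_split; apply: ler_sum_nat => m mN /=; have [m0 _] := andP mN.
  have [K0 KR k1 k2] := divn_bounds R mN.
  have := H _ (N%:R / m%:R) K0; rewrite k1 k2 => /(_ isT) h.
  rewrite -lerBlDl -mulrBr -[leRHS]mul1r; apply: le_trans (ler_norm _) _.
  by rewrite normrM ler_pM ?g1// mulrA.
apply: le_trans h1 _; rewrite -mulr_sumr.
have -> : \sum_(1 <= m < N.+1) g m * (2 * t m) = 2 * \sum_(1 <= m < N.+1) g m * t m.
  by rewrite mulr_sumr; apply: eq_bigr => m _; rewrite mulrCA.
rewrite (abel_sum t N G0) {1}/t divff ?gt_eqF// ln1 !mulr0 add0r.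
have h2 : \sum_(1 <= m < N) G m * (t m - t m.+1) <=
   \sum_(1 <= m < N) (N%:R * (G m / (m * m.+1)%:R * ln (N%:R / m%:R)) + N%:R / m%:R).
  apply: ler_sum_nat => m /andP[m0 mN].
  have Gm : 0 <= G m <= m%:R by rewrite normr_ge0 mulog_bound.
  have nz : (m%:R != 0 :> R) * (m.+1%:R != 0 :> R) by rewrite !pnatr_eq0 -lt0n.
  have /andP[d0 d1] := lnS_sub_bounds R m0.
  (* The first part is the main term; the second, multiplied by G(m) <= m, is at most N / m. *)
  have -> : t m - t m.+1 = N%:R * (ln (N%:R / m%:R) / (m * m.+1)%:R) +
     N%:R * ((ln m.+1%:R - ln m%:R) / m.+1%:R).
    by rewrite recip_mulS// /t !ln_div_nat//; ring.
  rewrite mulrDr lerD//; first by rewrite le_eqVlt; apply/orP; left; apply/eqP; ring.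
  have -> : G m * (N%:R * ((ln m.+1%:R - ln m%:R) / m.+1%:R)) =
     N%:R * (G m / m.+1%:R * (ln m.+1%:R - ln m%:R)) by ring.
  rewrite ler_wpM2l// -[leRHS]mul1r ler_pM// ?divr_ge0// ?ler_pdivrMr ?ltr0n//.
  - by case/andP: Gm.
  - by apply: le_trans d0; rewrite invr_ge0.
  - by case/andP: Gm => _ h; apply: le_trans h _; rewrite mul1r ler_nat.
rewrite big_split/= -!mulr_sumr in h2.
have h3 : \sum_(1 <= m < N) m%:R^-1 <= \sum_(1 <= m < N.+1) m%:R^-1 :> R.
  by rewrite [leRHS]big_nat_recr//= lerDl invr_ge0.
have h4 := harmonic_sum_le R N0.
have h5 := ler_wpM2l (ltW NR) (le_trans h3 h4).
have h6 := ler_wpM2l C0 hN; move: h2 h5 h6.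
set X := \sum_(_ <= _ < _) _; set Y := \sum_(_ <= _ < _) _.
set Z := \sum_(_ <= _ < _) _; set W := \sum_(_ <= _ < _) _.
lra.
Qed.

(** ln (N / m) is the sum of ln (n + 1) - ln n over m <= n < N. Exchanging sums produces the partial
    sums of [b], which become [logmean]. *)
Lemma sum_ln_weight (b : nat -> R) N : (0 < N)%N ->
  \sum_(1 <= m < N) b m * ln (N%:R / m%:R) =
  \sum_(1 <= n < N) (\sum_(1 <= m < n.+1) b m) * (ln n.+1%:R - ln n%:R).
Proof.
elim: N => // N IH _; have [->|N0] := posnP N; first by rewrite !big_geq.
rewrite [RHS]big_nat_recr//= -IH// mulr_suml (big_nat_recr N)//= [in RHS](big_nat_recr N)//=.
rewrite addrA -big_split ln_div_nat//=; congr (_ + _).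
by apply: eq_big_nat => m /andP[m0 _]; rewrite !ln_div_nat//=; ring.
Qed.

Lemma mulog_le_logmean : exists2 C : R, 0 <= C & forall N, (0 < N)%N ->
  `|mulog N| * ln N%:R ^+ 2 <=
  2 * N%:R * \sum_(1 <= n < N) logmean n * (ln n.+1%:R - ln n%:R) +
  C * N%:R * (1 + ln N%:R).
Proof.
have [C1 C10 H1] := mulog_ln2_le; have [C2 C20 H2] := sum_selbergLambda_mulog_le.
exists (C1 + C2) => [|N N0]; first by rewrite addr_ge0.
have := H1 N N0; have := H2 N N0; rewrite sum_ln_weight//.
rewrite -/(logmean _); lra.
Qed.

(** * Boundedness of the weighted sums of F *)

Lemma sum_mulog_by_parts N :
  \sum_(1 <= m < N.+1) mulog m / (m * m.+1)%:R =
  \sum_(1 <= m < N.+1) mertens m * ((ln m.+1%:R - ln m%:R) / m.+1%:R) -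
  mulog N.+1 / N.+1%:R.
Proof.
elim: N => [|N IH].
  by rewrite !big_geq// mulogS mulog0 /mertens big_geq// mul0r addr0 mul0r subr0.
rewrite big_nat_recr//= IH recip_mulS// [in RHS]big_nat_recr//= (mulogS N.+1).
by ring.
Qed.

Lemma sum_mertens_by_parts N :
  \sum_(1 <= m < N.+1) mertens m / (m * m.+1)%:R =
  \sum_(1 <= m < N.+1) mu m / m%:R - mertens N / N.+1%:R.
Proof.
elim: N => [|N IH]; first by rewrite /mertens !big_geq// mul0r subr0.
rewrite big_nat_recr//= IH recip_mulS// [in RHS]big_nat_recr//=.
have -> : mertens N.+1 = mertens N + mu N.+1 by rewrite /mertens big_nat_recr.
by ring.
Qed.

(** Two summations by parts lead to the sum of mu(m) / m, bounded by 2. The two boundary terms and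
    the replacement of ln (m + 1) - ln m by 1 / m cost at most 1 each. *)
Lemma sum_mulog_bounded N :
  `|\sum_(1 <= m < N.+1) mulog m / (m * m.+1)%:R| <= 5.
Proof.
rewrite sum_mulog_by_parts.
have h1 n : `|mulog n.+1 / n.+1%:R| <= 1.
  by rewrite normrM normfV [`|_%:R|]ger0_norm// ler_pdivrMr ?ltr0n// mul1r mulog_bound.
have h2 n : `|mertens n / n.+1%:R| <= 1.
  rewrite normrM normfV [`|_%:R|]ger0_norm// ler_pdivrMr ?ltr0n// mul1r.
  by apply: le_trans (mertens_bound n) _; rewrite ler_nat.
have := sum_mertens_by_parts N; have := norm_sum_mu_div R N.
have h3 : `|\sum_(1 <= m < N.+1) mertens m * ((ln m.+1%:R - ln m%:R) / m.+1%:R) -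
    \sum_(1 <= m < N.+1) mertens m / (m * m.+1)%:R| <= 1 - N.+1%:R^-1.
  have -> : 1 - N.+1%:R^-1 = \sum_(1 <= m < N.+1) (m%:R^-1 - m.+1%:R^-1) :> R.
    rewrite (eq_bigr (fun m => - (m.+1%:R^-1 - m%:R^-1))) => [|m _]; last by rewrite opprB.
    by rewrite sumrN telescope_sumr// invr1 opprB.
  rewrite -sumrB; apply: le_trans (ler_norm_sum _ _ _) _; apply: ler_sum_nat => m /andP[m0 _].
  rewrite -recip_mulS// -mulrBr natrM invfM.
  have mR : 0 < m%:R :> R by rewrite ltr0n.
  have := lnS_sub_bounds R m0; have := recip_mulS m0; rewrite natrM invfM.
  have : 0 < m.+1%:R^-1 :> R by rewrite invr_gt0 ltr0n.
  have : m%:R * m%:R^-1 = 1 :> R by rewrite divff ?gt_eqF.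
  have := mertens_bound m; set M := mertens m; set d := ln _ - ln _.
  set x := m%:R^-1; set y := m.+1%:R^-1 => hM mx y0 xy /andP[d0 d1].
  (* Here x - d lies between 0 and x - y = x y. With |M| <= m each term is then at most y^2 <= x y,
     which telescopes. *)
  have e : 0 <= x * y - d * y <= x * y * y by apply/andP; split; nra.
  have -> : M * (d * y - x * y) = - (M * (x * y - d * y)) by ring.
  have [e0 e1] := andP e.
  rewrite normrN normrM (ger0_norm e0).
  apply: le_trans (ler_pM _ _ hM e1) _ => //.
  by rewrite !mulrA mx mul1r; nra.
have y0 : 0 <= N.+1%:R^-1 :> R by rewrite invr_ge0.
move: h3; set S := \sum_(_ <= _ < _) _; set T := \sum_(_ <= _ < _) _.
set U := \sum_(_ <= _ < _) _ => h3 hU E.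
move: (h1 N) (h2 N) h3 hU y0; rewrite E.
set p := mulog _ / _; set q := mertens _ / _; set y := N.+1%:R^-1.
rewrite !ler_norml => /andP[? ?] /andP[? ?] /andP[? ?] /andP[? ?] ?.
by apply/andP; split; lra.
Qed.

End MoebiusLogSum.

(** * The Tauberian argument *)

Section Tauberian.
Variable R : realType.
Implicit Types (n k m A K N P Q : nat) (a al eps : R).
Local Notation F := (mulog R).
Local Notation B := (logmean R).

Lemma mulog_same_sign A P : (forall m, (A < m <= P)%N -> 1 < `|F m|) ->
  (forall m, (A < m <= P)%N -> 0 <= F m) \/ (forall m, (A < m <= P)%N -> F m <= 0).
Proof.
move=> big; have step m : (A < m)%N -> (m.+1 <= P)%N -> (0 <= F m) = (0 <= F m.+1).
  move=> Am mP; have := big m; have := big m.+1; rewrite Am mP (leqW Am) ltnW//.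
  move=> /(_ isT) h1 /(_ isT) h2; have := mulog_lipschitz R m.
  move: h1 h2; rewrite !lter_norml; set x := F m; set y := F m.+1.
  case: (lerP 0 x) => x0; case: (lerP 0 y) => y0 //.
    by rewrite (ger0_norm x0) (ltr0_norm y0) => ? ? /andP[? ?]; exfalso; lra.
  by rewrite (ltr0_norm x0) (ger0_norm y0) => ? ? /andP[? ?]; exfalso; lra.
have same m : (A < m)%N -> (m <= P)%N -> (0 <= F m) = (0 <= F A.+1).
  elim: m => // m IH; rewrite ltnS leq_eqVlt => /predU1P[->//|Am mP].
  by rewrite -step// IH// ltnW.
have [h|h] := boolP (0 <= F A.+1); [left|right] => m /andP[Am mP].
  by rewrite same.
by move: h; rewrite -(same m)// -ltNge => /ltW.
Qed.

Lemma logmeanB A N : (A <= N)%N ->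
  B N - B A = \sum_(A.+1 <= m < N.+1) `|F m| / (m * m.+1)%:R.
Proof.
move=> AN; apply/eqP; rewrite subr_eq addrC; apply/eqP.
by rewrite /logmean -(big_cat_nat (n := A.+1)).
Qed.

Lemma logmean_homo A N : (A <= N)%N -> B A <= B N.
Proof.
by move=> AN; rewrite -subr_ge0 logmeanB//; apply: sumr_ge0 => m _; rewrite divr_ge0.
Qed.

(** |F| is F or - F throughout the block, and the signed sum is a difference of two sums bounded by
    5. *)
Lemma logmean_same_sign A P : (A <= P)%N ->
  (forall m, (A < m <= P)%N -> 1 < `|F m|) -> B P - B A <= 10.
Proof.
move=> AP big.
have h : `|\sum_(A.+1 <= m < P.+1) F m / (m * m.+1)%:R| <= 10.
  have := sum_mulog_bounded R P; have := sum_mulog_bounded R A.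
  rewrite [in X in _ -> X -> _](big_cat_nat (n := A.+1))//=.
  rewrite !ler_norml => /andP[? ?] /andP[? ?]; apply/andP; split; lra.
rewrite logmeanB//; apply: le_trans h.
have [pos|neg] := mulog_same_sign big.
  rewrite -[leRHS]ger0_norm ?normr_ge0// normr_id.
  rewrite [leLHS](_ : _ = \sum_(A.+1 <= m < P.+1) F m / (m * m.+1)%:R); first exact: ler_norm.
  by apply: eq_big_nat => m mP; rewrite ger0_norm// pos.
rewrite -normrN -sumrN.
rewrite [leLHS](_ : _ = \sum_(A.+1 <= m < P.+1) - (F m / (m * m.+1)%:R)); first exact: ler_norm.
by apply: eq_big_nat => m mP; rewrite ler0_norm ?neg// mulNr.
Qed.

Lemma sum_recipS_le A N : (A <= N)%N ->
  \sum_(A.+1 <= m < N.+1) m.+1%:R^-1 <= ln N.+1%:R - ln A.+1%:R :> R.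
Proof.
elim: N => [|N IH]; first by rewrite leqn0 => /eqP->; rewrite big_geq// subrr.
rewrite leq_eqVlt => /predU1P[->|AN]; first by rewrite big_geq// subrr.
rewrite big_nat_recr//=; have := IH AN; have /andP[h _] := @lnS_sub_bounds R N.+1 isT.
move: h; set x := N.+2%:R^-1; set S := \sum_(_ <= _ < _) _; lra.
Qed.

Lemma weighted_ratio n (x : R) : (0 < n)%N -> x / (n * n.+1)%:R = x / n%:R / n.+1%:R.
Proof. by move=> n0; rewrite natrM invfM mulrA. Qed.

Lemma logmean_le A N al n0 : (forall n, (n0 <= n)%N -> `|F n| <= al * n%:R) ->
  0 <= al -> (n0 <= A <= N)%N -> B N - B A <= al * (ln N.+1%:R - ln A.+1%:R).
Proof.
move=> H al0 /andP[nA AN]; rewrite logmeanB//.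
apply: le_trans (ler_wpM2l al0 (sum_recipS_le AN)); rewrite mulr_sumr.
apply: ler_sum_nat => m /andP[Am _].
have m0 : (0 < m)%N by apply: leq_trans Am.
by rewrite weighted_ratio// ler_wpM2r ?invr_ge0// ler_pdivrMr ?ltr0n// H//; lia.
Qed.

Lemma mulog_near m n : (m <= n)%N -> `|F n| <= `|F m| + (n - m)%:R.
Proof.
move=> mn; rewrite -{1}(subnKC mn); elim: (n - m)%N => [|k IH]; first by rewrite addn0 addr0.
rewrite addnS -natr1; have := mulog_lipschitz R (m + k); move: IH; set x := F (m + k)%N.
move=> h1 h2; have := ler_normD (F (m + k).+1 - x) x; rewrite subrK; lra.
Qed.

(* As [F] is 1-Lipschitz, [`|F n| <= al * n / 2] for [n] between [m] and [(1 + a / 2) * m]. *)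
Lemma logmean_gain_near_zero A N m a al n0 : 0 < a <= al -> al <= 1 ->
  (forall n, (n0 <= n)%N -> `|F n| <= al * n%:R) ->
  (n0 <= A)%N -> 2 <= a * A%:R -> (A < m)%N -> (2 * m <= N)%N -> `|F m| <= 1 ->
  B N - B A <= al * (ln N.+1%:R - ln A.+1%:R) - a ^+ 2 / 16.
Proof.
move=> /andP[a0 aal] al1 H nA aA Am mN Fm; have al0 : 0 <= al by lra.
have AN : (A <= N)%N by lia.
have mR : 0 < m%:R :> R by rewrite ltr0n; exact: leq_ltn_trans Am.
have AmR : A%:R <= m%:R :> R by rewrite ler_nat ltnW.
have am : 2 <= a * m%:R by apply: le_trans aA _; rewrite ler_wpM2l// ltW.
(* The length of the stretch starting at m on which F is known to be small; a m >= 2 makes it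
   nonzero. *)
pose h := Num.truncn (a * m%:R / 2).
have hb : h%:R <= a * m%:R / 2 < h.+1%:R by apply: truncn_itv; lra.
have h0 : (0 < h)%N by rewrite truncn_gt0; lra.
have h1 : 1 <= h%:R :> R by rewrite ler1n.
have hm : (2 * h <= m)%N.
  rewrite -(ler_nat R) natrM; have [hb1 _] := andP hb.
  have : a * m%:R <= m%:R by rewrite ler_piMl; lra.
  lra.
rewrite lerBrDr -lerBrDl.
apply: le_trans (_ : al * (\sum_(A.+1 <= n < N.+1) n.+1%:R^-1) - (B N - B A) <= _); last first.
  by rewrite lerD2r ler_wpM2l// sum_recipS_le.
rewrite logmeanB// mulr_sumr -sumrB.
(* Every term of the difference is nonnegative, so it suffices to keep the stretch from m to m +
   h. *)
have D0 n : (A < n)%N -> 0 <= al / n.+1%:R - `|F n| / (n * n.+1)%:R.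
  move=> An; have n00 : (0 < n)%N := leq_ltn_trans (leq0n A) An.
  rewrite weighted_ratio// -mulrBl mulr_ge0 ?invr_ge0// subr_ge0 ler_pdivrMr ?ltr0n// H//.
  exact: leq_trans nA (ltnW An).
have mN1 : (m <= N.+1)%N by clear - mN; lia.
have mhN : (m + h <= N.+1)%N by clear - mN hm; lia.
rewrite (big_cat_nat (n := m))//= [X in _ + X](big_cat_nat (n := (m + h)%N))//= ?leq_addr//.
have s1 : 0 <= \sum_(A.+1 <= n < m) (al / n.+1%:R - `|F n| / (n * n.+1)%:R).
  by rewrite big_nat; apply: sumr_ge0 => n /andP[An _]; exact: D0.
have s3 : 0 <= \sum_(m + h <= n < N.+1) (al / n.+1%:R - `|F n| / (n * n.+1)%:R).
  by rewrite big_nat; apply: sumr_ge0 => n /andP[mn _]; apply: D0;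
    exact: leq_trans Am (leq_trans (leq_addr h m) mn).
have s2 : \sum_(m <= n < m + h) a / (4 * m%:R) <=
   \sum_(m <= n < m + h) (al / n.+1%:R - `|F n| / (n * n.+1)%:R).
  apply: ler_sum_nat => n /andP[mn nmh].
  have n00 : (0 < n)%N := leq_trans (leq_ltn_trans (leq0n A) Am) mn.
  have nR : 0 < n%:R :> R by rewrite ltr0n.
  have mnR : m%:R <= n%:R :> R by rewrite ler_nat.
  rewrite weighted_ratio// -mulrBl.
  have Fn : `|F n| <= h%:R.
    apply: le_trans (mulog_near mn) _; apply: (@le_trans _ _ (1 + (n - m)%:R)).
      by rewrite lerD2r.
    by rewrite nat1r ler_nat; clear - mn nmh; lia.
  have FnR : `|F n| / n%:R <= al / 2.
    rewrite ler_pdivrMr//; have [hb1 _] := andP hb.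
    have : a * m%:R <= al * n%:R by rewrite ler_pM//; lra.
    lra.
  have n2m : n.+1%:R <= 2 * m%:R :> R by rewrite -natrM ler_nat; clear - nmh hm; lia.
  have n1R : 0 < n.+1%:R :> R by rewrite ltr0n.
  rewrite ler_pdivlMr// mulrAC ler_pdivrMr; last by lra.
  apply: (@le_trans _ _ (al / 2 * (4 * m%:R))); last by rewrite ler_wpM2r//; lra.
  have : a * n.+1%:R <= al * (2 * m%:R) by rewrite ler_pM//; lra.
  lra.
rewrite sumr_const_nat addKn -mulr_natr in s2.
(* As h >= 1, a m / 2 < h + 1 <= 2 h, so h terms of size a / (4 m) add up to at least a^2 / 16. *)
have s4 : a ^+ 2 / 16 <= a / (4 * m%:R) * h%:R.
  rewrite [leRHS]mulrAC ler_pdivlMr; last by lra.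
  have [_ hb2] := andP hb; rewrite -natr1 in hb2.
  have : a * (a * m%:R) <= a * (4 * h%:R) by rewrite ler_pM2l//; lra.
  lra.
lra.
Qed.

(* Either [F] keeps its sign on [(A, Q * A]], where the boundedness of [sum_mulog_bounded]
   makes the weighted sum of [`|F|] negligible, or it comes close to [0] there. *)
Lemma logmean_block A N Q a al n0 : 0 < a <= al -> al <= 1 ->
  (forall n, (n0 <= n)%N -> `|F n| <= al * n%:R) ->
  11 <= a * ln (Q%:R / 2) -> (0 < Q)%N ->
  (n0 <= A)%N -> (0 < A)%N -> 2 <= a * A%:R -> (2 * Q * A <= N)%N ->
  B N - B A <= al * (ln N.+1%:R - ln A.+1%:R) - a ^+ 2 / 16.
Proof.
move=> aal al1 H hQ Q0 nA A0 aA QN; have [a0 aal'] := andP aal.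
have AP : (A <= Q * A)%N by rewrite leq_pmull.
have [[m [/andP[Am mP] Fm]]|big] :=
    pselect (exists m, (A < m <= Q * A)%N /\ `|F m| <= 1).
  by apply: (logmean_gain_near_zero aal al1 H nA aA Am _ Fm); lia.
have h1 : B (Q * A)%N - B A <= 10.
  apply: logmean_same_sign => // m mP; rewrite ltNge; apply/negP => Fm.
  by apply: big; exists m.
have h2 : B N - B (Q * A)%N <= al * (ln N.+1%:R - ln (Q * A).+1%:R).
  by apply: (logmean_le H); lia || lra.
(* (Q A + 1) / (A + 1) >= Q / 2, whence the quotient Q / 2 in the hypothesis. *)
have h3 : ln (Q%:R / 2) <= ln (Q * A).+1%:R - ln A.+1%:R :> R.
  have QR : 0 < Q%:R :> R by rewrite ltr0n.
  rewrite lerBrDr -lnM ?posrE ?ltr0n ?divr_gt0//.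
  rewrite ler_ln ?posrE ?ltr0n ?mulr_gt0 ?divr_gt0 ?ltr0n//.
  rewrite mulrAC ler_pdivrMr// -!natrM ler_nat; nia.
(* 11 covers the bound 10 of the constant-sign case and leaves 1 for the gain a^2 / 16. *)
have h4 : 11 <= al * (ln (Q * A).+1%:R - ln A.+1%:R).
  have h : 0 <= ln (Q%:R / 2) :> R by rewrite -(pmulr_rge0 _ a0) (le_trans _ hQ).
  by apply: le_trans hQ _; rewrite ler_pM// ltW.
have : a ^+ 2 <= 1 by rewrite expr_le1//; lra.
lra.
Qed.

(** * Lowering the constant and iterating *)

Lemma ln_nat_unbounded (x : R) : exists n0, forall n, (n0 <= n)%N -> x <= ln n%:R.
Proof.
exists (Num.truncn (expR x)).+1 => n hn; rewrite -[x]expRK ler_ln ?posrE ?expR_gt0//.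
  by apply: le_trans (ltW (truncnS_gt _)) _; rewrite ler_nat.
by rewrite ltr0n; lia.
Qed.

(** A left Riemann sum for the integral of t from 0 to ln N. *)
Lemma sum_ln_dln_le N : (0 < N)%N ->
  \sum_(1 <= n < N) ln n%:R * (ln n.+1%:R - ln n%:R) <= ln N%:R ^+ 2 / 2 :> R.
Proof.
elim: N => // N IH _; have [->|N0] := posnP N; first by rewrite big_geq// ln1; lra.
rewrite big_nat_recr//=; have := IH N0; set S := \sum_(_ <= _ < _) _.
by have := sqr_ge0 (ln N.+1%:R - ln N%:R : R); rewrite !expr2; lra.
Qed.

(** Inserted in [mulog_le_logmean], the hypothesis gives n (be ln^2 n + O(1 + ln n)). Dividing by
    ln^2 n leaves [be] plus a term that [phi] absorbs. *)
Lemma mulog_of_logmean (be C phi : R) : 0 <= be -> 0 <= C -> 0 < phi ->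
  (forall n, (0 < n)%N -> B n <= be * ln n%:R + C) ->
  exists n0, forall n, (n0 <= n)%N -> `|F n| <= (be + phi) * n%:R.
Proof.
move=> be0 C0 phi0 H; have [C1 C10 H1] := mulog_le_logmean R.
(* Beyond this point phi L^2 is at least the lower-order terms 2 C L + C1 (1 + L). *)
have [n0 Hn0] := ln_nat_unbounded (1 + (2 * C + 2 * C1) / phi).
exists n0.+1 => n n0n; have N0 : (0 < n)%N by lia.
have NR : 0 < n%:R :> R by rewrite ltr0n.
have := Hn0 n (ltnW n0n); have := H1 n N0; set L := ln n%:R => h1 hL.
have q0 : 0 <= (2 * C + 2 * C1) / phi by rewrite !(divr_ge0, addr_ge0, mulr_ge0)// ltW.
have L1 : 1 <= L by lra.
have hphi : 2 * C + 2 * C1 <= phi * L by rewrite -ler_pdivrMl// mulrC; lra.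
have h2 : \sum_(1 <= k < n) B k * (ln k.+1%:R - ln k%:R) <= be * (L ^+ 2 / 2) + C * L.
  apply: (@le_trans _ _ (\sum_(1 <= k < n) (be * (ln k%:R * (ln k.+1%:R - ln k%:R)) +
     C * (ln k.+1%:R - ln k%:R)))).
    apply: ler_sum_nat => k /andP[k0 _]; rewrite mulrA -mulrDl ler_wpM2r ?H//.
    by have /andP[h _] := lnS_sub_bounds R k0; apply: le_trans h; rewrite invr_ge0.
  rewrite big_split/= -!mulr_sumr lerD ?ler_wpM2l ?sum_ln_dln_le//.
  by rewrite telescope_sumr// ln1 subr0.
have L2 : 0 < L ^+ 2 by rewrite exprn_gt0//; lra.
rewrite -(ler_pM2r L2); apply: le_trans h1 _.
apply: (@le_trans _ _ (n%:R * (be * L ^+ 2 + 2 * C * L + C1 * (1 + L)))).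
  have := ler_wpM2l (ltW NR) h2; lra.
have -> : (be + phi) * n%:R * L ^+ 2 = n%:R * ((be + phi) * L ^+ 2) by ring.
rewrite ler_wpM2l//.
have : (2 * C + 2 * C1) * L <= phi * L * L by rewrite ler_wpM2r//; lra.
have : C1 <= C1 * L by rewrite ler_peMr.
by rewrite expr2; lra.
Qed.

(** By [logmean_block], each factor K = 2 Q in n saves a^2 / 16 in B, which lowers its slope in ln n
    from [al] to [al - g]. Half of [g] is spent as the slack of [mulog_of_logmean]. As Q, K and [g]
    depend on [a] alone, so does [phi]. *)
Lemma mulog_bound_improve a : 0 < a <= 1 -> exists2 phi, 0 < phi &
  forall al, a <= al <= 1 ->
  (exists n0, forall n, (n0 <= n)%N -> `|F n| <= al * n%:R) ->
  exists n0, forall n, (n0 <= n)%N -> `|F n| <= (al - phi) * n%:R.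
Proof.
move=> /andP[a0 a1].
have [q Hq] := ln_nat_unbounded (11 / a + ln 2).
pose Q := q.+1; have hQ : 11 <= a * ln (Q%:R / 2).
  rewrite ln_div ?posrE ?ltr0n// -ler_pdivrMl// mulrC lerBrDr.
  exact: Hq.
pose K := (2 * Q)%N; have K0 : (0 < K)%N by [].
have KE : ln K%:R = ln (Q%:R / 2) + 2 * ln 2 :> R.
  by rewrite ln_natM// ln_div ?posrE ?ltr0n//; ring.
have l2 : 0 < ln 2 :> R by rewrite ln_gt0// ltr1n.
have lK : 11 <= ln K%:R :> R.
  have h0 : 0 <= ln (Q%:R / 2) :> R by rewrite -(pmulr_rge0 _ a0) (le_trans _ hQ).
  have : a * ln (Q%:R / 2) <= ln (Q%:R / 2) by rewrite ler_piMl.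
  lra.
pose g := a ^+ 2 / 16 / ln K%:R.
have g0 : 0 < g by rewrite !divr_gt0 ?exprn_gt0//; lra.
exists (g / 2) => [|al /andP[aal al1] [n0 H]]; first by rewrite divr_gt0.
have [be bE] : exists be, be = al - g by exists (al - g).
have gK : g * ln K%:R = a ^+ 2 / 16 by rewrite divfK// gt_eqF//; lra.
have be0 : 0 <= be.
  have : g * 11 <= g * ln K%:R by rewrite ler_wpM2l// ltW.
  have : a * a <= a by rewrite ler_piMl// ltW.
  by rewrite bE; rewrite expr2 in gK; lra.
(* At least [n0] and at least 2 / a, as [logmean_block] requires of the start of a block. *)
pose A0 := (n0 + (Num.truncn (2 / a)).+1)%N.
have A0a A : (A0 <= A)%N -> 2 <= a * A%:R.
  move=> hA; rewrite -ler_pdivrMl// mulrC.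
  by apply: le_trans (ltW (truncnS_gt _)) _; rewrite ler_nat (leq_trans _ hA)// leq_addl.
(* Strong induction from [n %/ K] to n; the constant takes care of n < K A0. *)
have HB n : (0 < n)%N -> B n <= be * ln n%:R + B (K * A0)%N.
  elim/ltn_ind: n => n IH n00; have [nK|nK] := ltnP n (K * A0).
    apply: le_trans (logmean_homo (ltnW nK)) _.
    by rewrite lerDr mulr_ge0// ln_nat_ge0.
  have A0n : (A0 <= n %/ K)%N by rewrite leq_divRL// mulnC.
  have A00 : (0 < n %/ K)%N by apply: leq_trans A0n; rewrite /A0 addnS.
  have An : (n %/ K < n)%N by apply: ltn_Pdiv; rewrite // /K; clear; lia.
  have KA : (K * (n %/ K) <= n)%N by rewrite mulnC leq_divM.
  have a_al : 0 < a <= al by rewrite a0.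
  have := logmean_block a_al al1 H hQ isT (_ : n0 <= n %/ K)%N A00 (A0a _ A0n) KA.
  move=> /(_ (leq_trans (leq_addr _ _) A0n)) h1.
  have h2 : ln n.+1%:R - ln (n %/ K).+1%:R <= ln K%:R :> R.
    rewrite lerBlDr -ln_natM// ler_ln ?posrE ?ltr0n//.
    by rewrite ler_nat mulnC ltn_ceil.
  have h3 : ln (n %/ K)%:R + ln K%:R <= ln n%:R :> R.
    rewrite -ln_natM// ler_ln ?posrE ?ltr0n ?muln_gt0 ?A00//.
    by rewrite ler_nat leq_divM.
  have h4 := IH _ An A00.
  have al0 : 0 <= al by lra.
  have := ler_wpM2l al0 h2; have := ler_wpM2l be0 h3; rewrite mulrDr.
  have : be * ln K%:R = al * ln K%:R - a ^+ 2 / 16 by rewrite bE mulrBl gK.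
  lra.
have BK0 : 0 <= B (K * A0)%N by apply: sumr_ge0 => m _; rewrite divr_ge0.
have g20 : 0 < g / 2 by rewrite divr_gt0.
have [n1 H1] := mulog_of_logmean be0 BK0 g20 HB.
exists n1 => n hn; have -> : al - g / 2 = be + g / 2 by rewrite bE; lra.
exact: H1.
Qed.

Lemma mulog_littleo eps : 0 < eps ->
  exists n0, forall n, (n0 <= n)%N -> `|F n| <= eps * n%:R.
Proof.
move=> eps0; pose a := Num.min eps 1.
have a0 : 0 < a by rewrite lt_min eps0 ltr01.
have a1 : a <= 1 by rewrite ge_min lexx orbT.
have [phi phi0 H] := @mulog_bound_improve a (introT andP (conj a0 a1)).
(* Starting from the trivial bound 1, each application of [H] subtracts [phi]; the maximum lets the
   induction pass once the bound is at most [a]. *)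
have E j : exists n0, forall n, (n0 <= n)%N -> `|F n| <= Num.max a (1 - phi * j%:R) * n%:R.
  elim: j => [|j [n0 IH]].
    exists 0%N => n _; rewrite mulr0 subr0 (max_r a1) mul1r; exact: mulog_bound.
  have [h|h] := leP (1 - phi * j%:R) a.
    exists n0 => n hn; apply: le_trans (IH n hn) _; rewrite ler_wpM2r//.
    by rewrite (max_l h) le_max lexx.
  have [||n1 H1] := H (1 - phi * j%:R).
  - by rewrite ltW//= gerBl mulr_ge0// ltW.
  - by exists n0 => n hn; apply: le_trans (IH n hn) _; rewrite (max_r (ltW h)).
  - exists n1 => n hn; apply: le_trans (H1 n hn) _; rewrite ler_wpM2r//.
    by rewrite le_max -natr1; apply/orP; right; lra.
(* More than 1 / phi steps make 1 - phi j negative, which leaves the maximum a <= eps. *)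
have [n0 Hn] := E (Num.truncn phi^-1).+1.
exists n0 => n hn; apply: le_trans (Hn n hn) _; rewrite ler_wpM2r//.
rewrite max_l ?ge_min ?lexx//.
have : phi * phi^-1 <= phi * (Num.truncn phi^-1).+1%:R.
  by rewrite ler_wpM2l ?ltW// truncnS_gt.
by rewrite divff ?gt_eqF//; lra.
Qed.

(** * From integers to real arguments, and the upper limit *)

Lemma moebius_log_sum_littleo eps : 0 < eps ->
  exists Y : R, forall y, Y <= y -> `|moebius_log_sum y| <= eps * y.
Proof.
move=> eps0; have e20 : 0 < eps / 2 by rewrite divr_gt0.
have [n0 H] := mulog_littleo e20.
(* Half of eps y bounds F at the integer part of y; the other half absorbs the error 1 of
   [mulog_floor] once y >= 2 / eps. *)
exists (n0.+1%:R + 2 / eps) => y hy.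
have q0 : 0 < 2 / eps by rewrite divr_gt0.
have y1 : n0.+1%:R <= y by lra.
have y0 : 0 <= y by apply: le_trans y1.
have N0 : (n0 < Num.truncn y)%N by rewrite truncn_ge_nat.
have Npos : (0 < Num.truncn y)%N by lia.
have /andP[Ny yN] := truncn_itv y0.
have := @mulog_floor R (Num.truncn y) y Npos.
rewrite Ny natr1 ltW// => /(_ isT) h1.
have h2 := H _ (ltnW N0).
have -> : moebius_log_sum y = \sum_(1 <= k < (Num.truncn y).+1) mu R k * ln (y / k%:R) by [].
move: h1 h2; set S := \sum_(_ <= _ < _) _; set f := F _ => h1 h2.
have h3 : 1 <= eps / 2 * y.
  have h : eps * (2 / eps) = 2 by rewrite mulrCA divff ?mulr1// gt_eqF.
  have yq : 2 / eps <= y by apply: le_trans hy; rewrite lerDr.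
  by have := ler_wpM2l (ltW eps0) yq; rewrite h; lra.
have h4 : eps / 2 * (Num.truncn y)%:R <= eps / 2 * y by rewrite ler_wpM2l//; lra.
have := ler_normD (S - f) f; rewrite subrK; lra.
Qed.

End Tauberian.

Theorem theorem1 (R : realType) : limsup_scaled_sum R = 0%E.
Proof.
apply/eqP; rewrite eq_le; apply/andP; split; last first.
  by apply: limf_esup_ge0 => // x; rewrite lee_fin.
apply/lee_addgt0Pr => eps eps0; rewrite add0e.
have [Y HY] := @moebius_log_sum_littleo R eps eps0.
have Y0 : 0 <= `|Y| by [].
rewrite /limsup_scaled_sum limf_esupE.
(* The upper limit is at most the supremum over this neighbourhood of infinity, on which exp (sqrt
   x) >= 1 + sqrt x >= Y. *)
pose V : set R := [set x | `|Y| ^+ 2 < x]%classic.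
apply: (@le_trans _ _ (ereal_sup ((fun x => `|scaled_sum x|%:E) @` V)%classic)).
  apply: ereal_inf_lbound; exists V => //.
  by exists (`|Y| ^+ 2); split => //; exact: num_real.
apply: ge_ereal_sup => _ [x xV <-]; rewrite lee_fin /scaled_sum.
have x0 : 0 <= x by apply: ltW; apply: le_lt_trans xV; exact: sqr_ge0.
have Ys : `|Y| <= Num.sqrt x.
  by rewrite -(ger0_norm Y0) -sqrtr_sqr ler_wsqrtr// ltW.
have Ye : Y <= expR (Num.sqrt x).
  have := expR_ge1Dx (Num.sqrt x); have := ler_norm Y; lra.
rewrite normrM gtr0_norm ?expR_gt0// expRN ler_pdivrMl ?expR_gt0// mulrC.
exact: HY.
Qed.
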